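(* Assume: (a) $\|\Gamma\|_\infty=\sup_{q\in\hat{\mathcal S}}\sup_{i\in\mathbb N}|\Gamma_{ii}(q)|<\infty$; (b) there exist $c_\Gamma,L_\Gamma\in(0,\infty)$ with $\sup_{q\in\hat{\mathcal S}}\sup_{j\in\mathbb N}\sum_{i=1}^\infty|\Gamma_{ij}(q)|\le c_\Gamma$ and, for all $q,\tilde q\in\hat{\mathcal S}$, $\sup_{i\in\mathbb N}\sum_{j\ne i}|\Gamma_{ij}(\tilde q)-\Gamma_{ij}(q)|\le L_\Gamma\|\tilde q-q\|$; (c) there exist $c_b\in(0,\infty)$, a map $Db:\hat{\mathcal S}\to L(l_2,l_2)$ and $\theta_b:\hat{\mathcal S}\times\hat{\mathcal S}\to l_2$ such that for all $q,\tilde q\in\hat{\mathcal S}$, $b(\tilde q)-b(q)=Db(q)[\tilde q-q]+\theta_b(q,\tilde q)$, $\|\theta_b(q,\tilde q)\|\le c_b\|\tilde q-q\|^2$ and $\|Db(q)\|_{L(l_2,l_2)}\le c_b$; (d) $a(m)\sqrt m\,\|\mu^m(0)-p(0)\|\to0$ as $m\to\infty$ for some probability measure $p(0)$ on $\mathbb N$. For $\eta\in D([0,T]:l_2)$ let $$\bar I(\eta)=\inf_\psi\Big\{\tfrac12\|\psi\|_{L^2(\lambda)}^2\Big\},$$ the infimum being over all $\psi\in L^2(\lambda)$ such that for all $t\in[0,T]$ $$\eta(t)=\int_0^tDb(p(s))[\eta(s)]\,ds+\int_{[0,t]\times\mathbb X}G(p(s),y)\psi(s,y)\,\lambda(ds\,dy),$$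 and let $$I(\eta)=\inf_u\Big\{\tfrac12\int_0^T\sum_{i=1}^\infty\sum_{j\ne i}u_{ij}^2(s)\,ds\Big\},$$ the infimum being over all $u=\{u_{ij}\}_{i,j=1}^\infty$ with each $u_{ij}\in L^2([0,T]:\mathbb R)$ such that for all $t\in[0,T]$ $$\eta(t)=\int_0^tDb(p(s))[\eta(s)]\,ds+\int_0^t\sum_{i=1}^\infty\sum_{j\ne i}(\mathbf e_j-\mathbf e_i)\sqrt{p_i(s)\Gamma_{ij}(p(s))}\,u_{ij}(s)\,ds .$$ (Infima over the empty set are $\infty$.) Then $I=\bar I$ on $D([0,T]:l_2)$.
   Context: Fix $T\in(0,\infty)$ and a positive sequence $a(m)$ with $a(m)\to0$, $a(m)\sqrt m\to\infty$. $l_2$ is the Hilbert space of square-summable real sequences with norm $\|\cdot\|$ and unit vectors $\mathbf e_i$; $L(l_2,l_2)$ is the space of bounded linear operators on it. $\hat{\mathcal S}=\{q\in l_2:\sum_jq_j=1,\ q_j\ge0\}$, identified with the probability measures on $\mathbb N$. For each $q\in\hat{\mathcal S}$, $\Gamma(q)=(\Gamma_{ij}(q))_{i,j\ge1}$ is a rate matrix: $\Gamma_{ij}(q)\ge0$ for $i\ne j$, $\Gamma_{ii}(q)=-\sum_{j\ne i}\Gamma_{ij}(q)>-\infty$. The map $b:\hat{\mathcal S}\to l_2$ is $b(q)=\sum_{i}\big(\sum_{j}q_j\Gamma_{ji}(q)\big)\mathbf e_i$. $\mu^m(0)=\frac1m\sum_{i=1}^m\delta_{x_i^m}$ for given $x_i^m\in\mathbb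 N$. $\mathbb X=\mathbb R_+^2$, and $\lambda$ is Lebesgue measure on $[0,T]\times\mathbb X$. For $i\ne j$, $A_{ij}(q)=\{y\in\mathbb X: i-1<y_1\le i,\ (j-1)\|\Gamma\|_\infty<y_2\le(j-1)\|\Gamma\|_\infty+q_i\Gamma_{ij}(q)\}$, and $G(q,y)=\sum_{i}\sum_{j\ne i}(\mathbf e_j-\mathbf e_i)\mathbf 1_{A_{ij}(q)}(y)\in l_2$. $p$ is the unique continuous ($\hat{\mathcal S}$-valued) solution of $p(t)=p(0)+\int_0^tb(p(s))ds$, $t\in[0,T]$, with $p(0)$ as in (d). $D([0,T]:l_2)$ is the space of right-continuous $l_2$-valued functions on $[0,T]$ with left limits. *)

(* Defs.v *)
From HB Require Import structures.
From mathcomp Require Import all_boot all_order all_algebra.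
From mathcomp Require Import all_classical all_reals all_analysis.
From mathcomp Require Import ring lra.

Set Implicit Arguments.
Unset Strict Implicit.
Unset Printing Implicit Defensive.
Import Order.TTheory GRing.Theory Num.Theory.
Import numFieldNormedType.Exports.

Local Open Scope classical_set_scope.
Local Open Scope ring_scope.

(** Series in normed spaces: limits of the partial sums. The library has these
    notations in [ereal_scope] only. Where the series diverges the value is
    unspecified. *)
Notation "\sum_ ( i '<oo' | P ) F" :=
  (\big[+%R/0%R]_(0 <= i <oo | P%B) F%R) (only parsing) : ring_scope.
Notation "\sum_ ( i '<oo' ) F" :=
  (\big[+%R/0%R]_(0 <= i <oo) F%R) (only parsing) : ring_scope.

(** * The Hilbert space l_2

    The countable state space {1, 2, ...} is represented by [nat], the state
    [i] of the mathematical text being the natural number [i - 1]. *)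

Definition square_summable (R : realType) : {pred (nat -> R)} :=
  [pred x : nat -> R | `[< cvgn (series (fun k => x k ^+ 2)) >]].
Arguments square_summable R : clear implicits.

Lemma square_summableP (R : realType) (x : nat -> R) :
  x \in square_summable R <-> cvgn (series (fun k => x k ^+ 2)).
Proof. by split => [/asboolP|/asboolP]. Qed.

Lemma square_summable_submod (R : realType) : submod_closed (square_summable R).
Proof.
split.
  apply/square_summableP; rewrite (_ : series _ = cst 0); first exact: is_cvg_cst.
  by apply/funext => n; rewrite /series/= big1// => k _; rewrite expr0n.
move=> a x y /square_summableP cx /square_summableP cy; apply/square_summableP.
apply: (@series_le_cvg _ _ (fun k => 2 * a ^+ 2 * x k ^+ 2 + 2 * y k ^+ 2)).
- by move=> k; exact: sqr_ge0.
- by move=> k; rewrite addr_ge0// mulr_ge0// ?sqr_ge0// mulr_ge0// sqr_ge0.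
- move=> k; rewrite -subr_ge0.
  rewrite (_ : _ - _ = (a * x k - y k) ^+ 2) ?sqr_ge0//.
  rewrite (_ : (a *: x + y) k = a * x k + y k)//.
  ring.
- exact: (is_cvg_seriesD (is_cvg_seriesZ (k := 2 * a ^+ 2) cx)
    (is_cvg_seriesZ (k := 2) cy)).
Qed.

HB.instance Definition _ (R : realType) :=
  GRing.isSubmodClosed.Build R (nat -> R) (square_summable R)
    (square_summable_submod R).

Record l2 (R : realType) := L2 {
  l2_fun :> nat -> R ;
  l2_funP : l2_fun \in square_summable R }.

HB.instance Definition _ (R : realType) := [isSub for @l2_fun R].
HB.instance Definition _ (R : realType) := [Choice of l2 R by <:].
HB.instance Definition _ (R : realType) :=
  [SubChoice_isSubLmodule of l2 R by <:].

Definition l2_norm (R : realType) (x : l2 R) : R :=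
  Num.sqrt (\sum_(k <oo) x k ^+ 2).

Section l2_norm_theory.
Context (R : realType).
Implicit Types x y : l2 R.

Lemma l2_cvg x : cvgn (series (fun k => x k ^+ 2)).
Proof. exact/square_summableP/l2_funP. Qed.

Lemma l2_sqr_sum_ge x n : \sum_(0 <= k < n) x k ^+ 2 <= \sum_(k <oo) x k ^+ 2.
Proof.
apply: (@nondecreasing_cvgn_le _ (series (fun k => x k ^+ 2))).
  by apply: nondecreasing_series => k _ _; exact: sqr_ge0.
exact: l2_cvg.
Qed.

Lemma l2_sqr_sum_ge0 x : 0 <= \sum_(k <oo) x k ^+ 2.
Proof. by have := l2_sqr_sum_ge x 0; rewrite big_geq. Qed.

Lemma sqr_l2_norm x : l2_norm x ^+ 2 = \sum_(k <oo) x k ^+ 2.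
Proof. by rewrite sqr_sqrtr// l2_sqr_sum_ge0. Qed.

Lemma l2_norm_ge0 x : 0 <= l2_norm x.
Proof. exact: sqrtr_ge0. Qed.

Lemma l2_norm0_eq0 x : l2_norm x = 0 -> x = 0.
Proof.
move=> x0; apply/val_inj/funext => k /=; apply/eqP.
rewrite -[_ == _]sqrf_eq0 eq_le sqr_ge0 andbT.
rewrite -[leRHS](expr0n R 2) -[in leRHS]x0 sqr_l2_norm.
apply: le_trans (l2_sqr_sum_ge x k.+1).
by rewrite big_nat_recr//= lerDr sumr_ge0// => i _; exact: sqr_ge0.
Qed.

Lemma l2_normZ (a : R) x : l2_norm (a *: x) = `|a| * l2_norm x.
Proof.
rewrite /l2_norm -sqrtr_sqr -sqrtrM ?sqr_ge0//; congr Num.sqrt.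
apply: etrans (lim_seriesZ (a ^+ 2) (@l2_cvg x)).
congr (lim (_ @ \oo)); apply/funext => n.
by apply: eq_bigr => k _ /=; rewrite exprMn.
Qed.

Lemma ler_l2_normD x y : l2_norm (x + y) <= l2_norm x + l2_norm y.
Proof.
have [/l2_norm0_eq0 ->|x0] := eqVneq (l2_norm x) 0.
  by rewrite add0r lerDr l2_norm_ge0.
have [/l2_norm0_eq0 ->|y0] := eqVneq (l2_norm y) 0.
  by rewrite addr0 lerDl l2_norm_ge0.
have {}x0 : 0 < l2_norm x by rewrite lt_neqAle eq_sym x0 l2_norm_ge0.
have {}y0 : 0 < l2_norm y by rewrite lt_neqAle eq_sym y0 l2_norm_ge0.
rewrite -ler_sqr ?nnegrE ?addr_ge0 ?l2_norm_ge0// sqr_l2_norm.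
apply: limr_le; first exact: l2_cvg.
apply: nearW => n.
set A := l2_norm x in x0 *; set B := l2_norm y in y0 *.
apply: (@le_trans _ _ (\sum_(0 <= k < n)
    ((1 + B / A) * x k ^+ 2 + (1 + A / B) * y k ^+ 2))).
  apply: ler_sum => k _; rewrite -subr_ge0.
  rewrite (_ : (x + y) k = x k + y k)//.
  rewrite (_ : _ - _ = (B * x k - A * y k) ^+ 2 / (A * B)).
    by rewrite mulr_ge0 ?sqr_ge0// invr_ge0 mulr_ge0// ltW.
  by field; rewrite !gt_eqF.
rewrite big_split/= -!mulr_sumr.
apply: (@le_trans _ _ ((1 + B / A) * A ^+ 2 + (1 + A / B) * B ^+ 2)).
  rewrite lerD// ler_wpM2l ?addr_ge0 ?divr_ge0 ?(ltW x0) ?(ltW y0)//.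
    by rewrite sqr_l2_norm; exact: l2_sqr_sum_ge.
  by rewrite sqr_l2_norm; exact: l2_sqr_sum_ge.
rewrite le_eqVlt; apply/orP; left; apply/eqP.
by field; rewrite !gt_eqF.
Qed.

End l2_norm_theory.

HB.instance Definition _ (R : realType) :=
  @Lmodule_isNormed.Build R (l2 R) (@l2_norm R)
    (@ler_l2_normD R) (@l2_normZ R) (@l2_norm0_eq0 R).

Lemma unit_vector_subproof (R : realType) (i : nat) :
  (fun k => (k == i)%:R) \in square_summable R.
Proof.
apply/square_summableP; apply: (@is_cvg_near_cst _ _ (1 : R)).
exists i.+1 => // n /= ni; rewrite /series/= (bigD1_seq i)/= ?iota_uniq//.
  rewrite eqxx expr1n big1 ?addr0// => k /negPf ->; exact: expr0n.
by rewrite mem_index_iota.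
Qed.

Definition unit_vector (R : realType) (i : nat) : l2 R :=
  L2 (unit_vector_subproof R i).

(** The operator norm of [L(l_2, l_2)], as an extended real number: a linear map
    is a bounded operator exactly when it is finite. *)
Definition op_norm (R : realType) (A : l2 R -> l2 R) : \bar R :=
  ereal_sup [set (`|A x|)%:E | x in [set x : l2 R | `|x| <= 1]].

(** Probability measures on the state space, as elements of l_2. *)
Definition simplex (R : realType) : set (l2 R) :=
  [set q | (\sum_(j <oo) (q j)%:E = 1)%E /\ forall j, 0 <= q j].

Definition empirical (R : realType) (m : nat) (x : 'I_m -> nat) : l2 R :=
  m%:R^-1 *: \sum_(i < m) unit_vector R (x i).

(** * Bochner integral

    For a function with values in a normed space: [v] is the integral of [f]
    over [D] if [f] is the a.e. limit of simple functions [s n] with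
    [\int_D |f - s n| --> 0] and [\int_D s n --> v]. *)

Record simple_fun d (T : measurableType d) (R : realType)
    (V : normedModType R) := SimpleF {
  sf_size : nat ;
  sf_set : 'I_sf_size -> set T ;
  sf_val : 'I_sf_size -> V ;
  sf_measurable : forall k, measurable (sf_set k) }.
Arguments sf_set {d T R V} s k.
Arguments sf_val {d T R V} s k.

Definition sf_fun d (T : measurableType d) (R : realType)
    (V : normedModType R) (s : simple_fun T V) (x : T) : V :=
  \sum_k (\1_(sf_set s k) x : R) *: sf_val s k.

Definition sf_integral d (T : measurableType d) (R : realType)
    (V : normedModType R) (mu : {measure set T -> \bar R}) (D : set T)
    (s : simple_fun T V) : V :=
  \sum_k fine (mu (D `&` sf_set s k)) *: sf_val s k.

Definition is_bochner_integral d (T : measurableType d) (R : realType)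
    (V : normedModType R) (mu : {measure set T -> \bar R}) (D : set T)
    (f : T -> V) (v : V) : Prop :=
  exists s : nat -> simple_fun T V,
    [/\ forall n k, (mu (D `&` sf_set (s n) k) < +oo)%E,
        {ae mu, forall x, D x -> (fun n => sf_fun (s n) x) @ \oo --> f x},
        (fun n => \int[mu]_(x in D) (`|f x - sf_fun (s n) x|)%:E)%E @ \oo
          --> 0%E &
        (fun n => sf_integral mu D (s n)) @ \oo --> v].

Definition L2_fun d (T : measurableType d) (R : realType)
    (mu : {measure set T -> \bar R}) (D : set T) : set (T -> R) :=
  [set f : T -> R | measurable_fun D f /\ (\int[mu]_(x in D) (f x ^+ 2)%:E < +oo)%E].

(** * The spaces [\mathbb X] and [D([0, T] : l_2)] *)

Definition XX (R : realType) : set (R * R) := `[0, +oo[ `*` `[0, +oo[.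

Section plane.
Context (R : realType).
Local Notation mu := (@lebesgue_measure R).

Definition lebesgue2 := (mu \x mu)%E.

HB.instance Definition _ := Measure.on lebesgue2.

Lemma lebesgue2_sigma_finite : sigma_finite setT lebesgue2.
Proof.
exists (fun n : nat => `[- n%:R, n%:R]%classic `*` `[- n%:R, n%:R]%classic).
  apply/esym; rewrite -subTset => -[x y] _.
  exists (Num.truncn (Num.max `|x| `|y|)).+1 => //=.
  have : Num.max `|x| `|y| <= (Num.truncn (Num.max `|x| `|y|)).+1%:R.
    by rewrite ltW// truncnS_gt.
  by rewrite ge_max !ler_norml !in_itv/= => /andP[-> ->].
move=> n; split; first exact: measurableX.
rewrite /lebesgue2 product_measure1E//= lebesgue_measure_itv/=.
by case: ifPn => _; rewrite ?mul0e ?ltry// -EFinD -EFinM ltry.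
Qed.

HB.instance Definition _ :=
  Measure_isSigmaFinite.Build _ _ _ lebesgue2 lebesgue2_sigma_finite.

(** Lebesgue measure on pairs [(s, y)] of a time and a point of the plane; it is
    only used on subsets of [[0, T] x XX]. *)
Definition lambda := (mu \x lebesgue2)%E.
HB.instance Definition _ := Measure.on lambda.


End plane.

(** A path on [[0, T]] is represented by a function on the whole of [R] of which
    only the values on [[0, T]] matter. *)
Definition cadlag (R : realType) (V : normedModType R) (T : R)
    (eta : R -> V) : Prop :=
  (forall t, 0 <= t < T -> eta s @[s --> t^'+] --> eta t) /\
  (forall t, 0 < t <= T -> cvg (eta s @[s --> t^'-])).

(** * Rates

    Maps defined on the simplex are represented by functions on the whole of
    [l2 R], of which only the values on [simplex R] matter. *)

Definition rate_matrix (R : realType) (Q : nat -> nat -> R) : Prop :=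
  (forall i j, i != j -> 0 <= Q i j) /\
  (forall i, \sum_(j <oo | j != i) (Q i j)%:E = (- Q i i)%:E)%E.

Section model.
Context (R : realType) (Gamma : l2 R -> nat -> nat -> R).

Definition rate_sup : \bar R :=
  ereal_sup [set ereal_sup (range (fun i => (`|Gamma q i i|)%:E))
            | q in @simplex R].

Definition drift (q : l2 R) : l2 R :=
  \sum_(i <oo) (\sum_(j <oo) q j * Gamma q j i : R) *: unit_vector R i.

Definition jump_set (q : l2 R) (i j : nat) : set (R * R) :=
  [set y | [/\ XX y, i%:R < y.1 <= i.+1%:R &
     j%:R * fine rate_sup < y.2 <= j%:R * fine rate_sup + q i * Gamma q i j]].

Definition jump (q : l2 R) (y : R * R) : l2 R :=
  \sum_(i <oo) \sum_(j <oo | j != i)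
    (\1_(jump_set q i j) y : R) *: (unit_vector R j - unit_vector R i).

Definition mean_field_solution (T : R) (p : R -> l2 R) : Prop :=
  [/\ forall t, 0 <= t <= T -> simplex (p t),
      {within `[0, T], continuous p} &
      forall t, 0 <= t <= T -> exists2 v : l2 R,
        is_bochner_integral (@lebesgue_measure R) `[0, t]
          (fun s => drift (p s)) v &
        p t = p 0 + v].

Context (T : R) (p : R -> l2 R) (Db : l2 R -> {linear l2 R -> l2 R}).

(** The controlled equations: both Bochner integrals exist and their values
    satisfy the identity. For [u] of finite cost the double series below
    converges absolutely for almost every [s]; controls of infinite cost do not
    affect the infimum in [rate_I]. *)

Definition controlled_by_psi (eta : R -> l2 R) (psi : R * (R * R) -> R) : Prop :=
  forall t, 0 <= t <= T -> exists v w : l2 R,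
    [/\ is_bochner_integral (@lebesgue_measure R) `[0, t]
          (fun s => Db (p s) (eta s)) v,
        is_bochner_integral (@lambda R) (`[0, t] `*` @XX R)
          (fun z => psi z *: jump (p z.1) z.2) w &
        eta t = v + w].

Definition Ibar (eta : R -> l2 R) : \bar R :=
  ereal_inf [set (2^-1%:E * \int[@lambda R]_(z in `[0%R, T] `*` @XX R)
                    (psi z ^+ 2)%:E)%E
            | psi in [set psi | L2_fun (@lambda R) (`[0, T] `*` @XX R) psi /\
                                controlled_by_psi eta psi]].

Definition controlled_by_u (eta : R -> l2 R) (u : nat -> nat -> R -> R) : Prop :=
  forall t, 0 <= t <= T -> exists v w : l2 R,
    [/\ is_bochner_integral (@lebesgue_measure R) `[0, t]
          (fun s => Db (p s) (eta s)) v,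
        is_bochner_integral (@lebesgue_measure R) `[0, t]
          (fun s => \sum_(i <oo) \sum_(j <oo | j != i)
             (Num.sqrt (p s i * Gamma (p s) i j) * u i j s) *:
               (unit_vector R j - unit_vector R i)) w &
        eta t = v + w].

Definition rate_I (eta : R -> l2 R) : \bar R :=
  ereal_inf [set (2^-1%:E * \int[@lebesgue_measure R]_(s in `[0%R, T])
                    (\sum_(i <oo) \sum_(j <oo | j != i) (u i j s ^+ 2)%:E))%E
            | u in [set u : nat -> nat -> R -> R |
                (forall i j, L2_fun (@lebesgue_measure R) `[0, T] (u i j)) /\
                controlled_by_u eta u]].

End model.

(* Main.v *)
Require Import Defs.
From HB Require Import structures.
From mathcomp Require Import all_boot all_order all_algebra.
From mathcomp Require Import all_classical all_reals all_analysis.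
From mathcomp Require Import measurable_realfun.
From mathcomp Require Import ring lra.

Set Implicit Arguments.
Unset Strict Implicit.
Unset Printing Implicit Defensive.
Import Order.TTheory GRing.Theory Num.Theory.
Import numFieldNormedType.Exports.

Local Open Scope classical_set_scope.
Local Open Scope ring_scope.

(** Fix a time s and write Q_ij = p_i(s) Gamma_ij(p(s)) for the flux from i
    to j. The sets A_ij(p(s)) of the plane are pairwise disjoint, and
    A_ij(p(s)) is a rectangle of area Q_ij, so G(p(s), y) is e_j - e_i on
    A_ij(p(s)) and 0 outside all these sets. A control psi thus acts on the
    equation only through the masses c_ij(s) that psi(s, .) gives to the
    sets A_ij(p(s)), and a control u acts only through the products
    sqrt(Q_ij) u_ij(s). When these two families agree, both controls drive
    the same equation ([bochner_transfer]).

    From psi one takes u_ij = c_ij / sqrt(Q_ij); by the Cauchy-Schwarz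
    inequality on each A_ij and disjointness, the sum of the u_ij^2 is at
    most the integral of psi(s, .)^2 ([cell_cost_le]). From a control u of
    finite cost one takes psi equal to u_ij / sqrt(Q_ij) on A_ij, whose
    squared norm is the sum of the u_ij^2 over the transitions with Q_ij > 0
    ([spread_control_cost]). Each infimum is therefore at most the other.

    The work lies in the integrals. A function with values in l_2,
    measurable coordinate by coordinate and of integrable norm, has a
    Bochner integral, and the latter is computed coordinatewise
    ([bochner_weakP]). The sums of the fluxes being at most the supremum of
    the rates, psi G(p, .) has integrable norm: |psi| <= psi^2 + 1 on a set
    of finite measure ([integrable_dominated]). Dominated convergence,
    applied to the double series over the transitions, identifies the
    integral over the plane at a fixed time with the series of the c_ij (e_j
    - e_i) ([series_weak_integral]), and Fubini's theorem in each coordinate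
    does the rest ([integral_weighted_jump]). Joint measurability in time
    and space follows from the continuity of s |-> Q_ij(s), that is, from
    the Lipschitz bound on the off-diagonal rates. *)

(** * Coordinates in l_2 *)

Section l2_coordinates.
Context (R : realType).
Implicit Types (x y : l2 R) (k n : nat).

Lemma l2E_norm x : `|x| = l2_norm x. Proof. by []. Qed.

Lemma l2_coordB x y k : (x - y) k = x k - y k. Proof. by []. Qed.

Lemma l2_coordZ (a : R) x k : (a *: x) k = a * x k. Proof. by []. Qed.

Lemma l2_coord_sum I (r : seq I) (P : pred I) (F : I -> l2 R) k :
  (\sum_(i <- r | P i) F i) k = \sum_(i <- r | P i) F i k.
Proof. by elim/big_ind2 : _ => // x a y b <- <-. Qed.

Lemma l2P x y : (forall k, x k = y k) -> x = y.
Proof. by move=> xy; apply/val_inj/funext. Qed.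

Lemma l2_sum_sqr_le x n : \sum_(0 <= k < n) x k ^+ 2 <= `|x| ^+ 2.
Proof. by rewrite sqr_l2_norm; exact: l2_sqr_sum_ge. Qed.

Lemma l2_coord_le x k : `|x k| <= `|x|.
Proof.
rewrite -ler_sqr ?nnegrE// real_normK ?num_real//.
apply: le_trans (l2_sum_sqr_le x k.+1).
by rewrite big_nat_recr//= lerDr sumr_ge0// => i _; exact: sqr_ge0.
Qed.

Lemma l2_norm_le x (c : R) : 0 <= c ->
  (forall n, \sum_(0 <= k < n) x k ^+ 2 <= c ^+ 2) -> `|x| <= c.
Proof.
move=> c0 H; rewrite -ler_sqr ?nnegrE//.
rewrite (_ : `|x| = l2_norm x)// sqr_l2_norm.
apply: limr_le; first exact: l2_cvg.
by apply: nearW => n; exact: H.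
Qed.

(** A sequence with bounded partial sums of squares is an element of l_2. *)
Lemma l2_intro (f : nat -> R) (c : R) :
  (forall n, \sum_(0 <= k < n) f k ^+ 2 <= c) ->
  exists x : l2 R, forall k, x k = f k.
Proof.
move=> H; suff fP : f \in square_summable R by exists (L2 fP).
apply/square_summableP; apply: nondecreasing_is_cvgn.
  by apply: nondecreasing_series => k _ _; exact: sqr_ge0.
by exists c => _ [n _ <-]; exact: H.
Qed.

Lemma l2_coord_cvg (u : nat -> l2 R) x k :
  u n @[n --> \oo] --> x -> u n k @[n --> \oo] --> x k.
Proof.
move=> ux; apply/cvgrPdist_le => e e0.
move/cvgrPdist_le : ux => /(_ e e0); apply: filterS => n.
by apply: le_trans; rewrite -l2_coordB; exact: l2_coord_le.
Qed.

Lemma norm_unit_vector i : `|unit_vector R i| <= 1.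
Proof.
apply: l2_norm_le => // n; rewrite expr1n.
have [ni|ni] := leqP n i.
  rewrite big_nat big1// => k /andP[_ kn].
  by rewrite /= ltn_eqF ?expr0n// (leq_trans kn).
rewrite (bigD1_seq i)/= ?iota_uniq ?mem_index_iota//.
rewrite eqxx expr1n big1 ?addr0// => k /negPf /= ->.
by rewrite expr0n.
Qed.

Lemma norm_unit_vectorB i j : `|unit_vector R j - unit_vector R i| <= 2.
Proof.
apply: le_trans (ler_normB _ _) _.
have := norm_unit_vector i; have := norm_unit_vector j; lra.
Qed.

(** Coordinatewise convergence together with a domination of the remainder by
    the limit gives convergence in norm: the tails of the remainders are
    controlled by those of the limit. *)
Lemma l2_cvg_dominated (u : nat -> l2 R) x :
  (forall k, u n k @[n --> \oo] --> x k) ->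
  (forall n k, `|x k - u n k| <= `|x k|) ->
  u n @[n --> \oo] --> x.
Proof.
move=> cu du; apply/cvgrPdist_le => e e0.
have e20 : 0 < e ^+ 2 / 2 by rewrite divr_gt0// exprn_gt0.
have [N _ HN] : \forall N \near \oo,
    `|x| ^+ 2 - \sum_(0 <= k < N) x k ^+ 2 <= e ^+ 2 / 2.
  have /cvgrPdist_le /(_ _ e20) := @l2_cvg R x.
  apply: filterS => N; rewrite -sqr_l2_norm -l2E_norm; apply: le_trans.
  exact: ler_norm.
have {}HN := HN N (leqnn _).
have addc : continuous (fun z : R * R => z.1 + z.2).
  by move=> z; apply: cvgD; [exact: cvg_fst|exact: cvg_snd].
have : \sum_(0 <= k < N) (x k - u n k) ^+ 2 @[n --> \oo] -->
    \sum_(0 <= k < N) (x k - x k) ^+ 2.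
  apply: (@cvg_big R nat +%R 0 xpredT addc nat \oo (index_iota 0 N)
    (fun k n => (x k - u n k) ^+ 2) (fun k => (x k - x k) ^+ 2)) => k _.
  rewrite expr2; under eq_fun do rewrite expr2.
  by apply: cvgM; apply: cvgB => //; exact: cvg_cst.
rewrite [X in _ --> X -> _]big1; last by move=> k _; rewrite subrr expr0n.
move/cvgrPdist_le => /(_ _ e20); apply: filterS => n.
rewrite distrC subr0 => Hn.
apply: l2_norm_le; first exact: ltW.
move=> M; apply: (@le_trans _ _ (\sum_(0 <= k < maxn N M) (x - u n) k ^+ 2)).
  rewrite (big_cat_nat (leq0n _) (leq_maxr N M))/= lerDl sumr_ge0// => k _.
  exact: sqr_ge0.
rewrite (big_cat_nat (leq0n _) (leq_maxl N M))/= [leRHS]splitr lerD//.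
  by apply: le_trans Hn; exact: ler_norm.
apply: le_trans HN; rewrite lerBrDl.
apply: le_trans (l2_sum_sqr_le x (maxn N M)).
rewrite [leRHS](big_cat_nat (leq0n _) (leq_maxl N M))/= lerD2l.
apply: ler_sum => k _.
by rewrite -[leLHS]real_normK ?num_real// -[leRHS]real_normK ?num_real//
  lerXn2r ?nnegrE ?normr_ge0// du.
Qed.

End l2_coordinates.

(** * Coordinatewise integration of l_2-valued functions *)

Section lower_integral.
Context d (T : measurableType d) (R : realType).
Variable mu : {measure set T -> \bar R}.
Local Open Scope ereal_scope.

Import HBNNSimple.

(** The integral of a nonnegative function is the supremum of the integrals of
    the simple functions below it, hence is monotone without any measurability
    assumption. *)
Lemma le_lower_integral (f g : T -> \bar R) (D E : set T) :
  (forall x, D x -> 0 <= f x) -> (forall x, E x -> 0 <= g x) ->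
  (forall x, D x -> E x /\ f x <= g x) ->
  \int[mu]_(x in D) f x <= \int[mu]_(x in E) g x.
Proof.
move=> f0 g0 fg; rewrite !ge0_integralE//; apply: le_ereal_sup => _ [h hf <-].
exists h => // x; apply: le_trans (hf x) _; rewrite !patchE.
case: ifPn => [/set_mem Dx|_]; last first.
  by case: ifPn => // /set_mem; exact: g0.
have [Ex fgx] := fg x Dx.
by rewrite mem_set.
Qed.

End lower_integral.

Section coord_measurable.
Context d (T : measurableType d) (R : realType).
Implicit Types (D : set T) (f g : T -> l2 R).

(** Measurability of l_2-valued functions, coordinate by coordinate. *)
Definition coord_measurable D f :=
  forall k, measurable_fun D (fun x => f x k).

Lemma coord_measurable_norm D f :
  coord_measurable D f -> measurable_fun D (fun x => `|f x|).
Proof.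
move=> mf; rewrite (_ : (fun _ => _) =
  Num.sqrt \o (fun x => limn (series (fun k => f x k ^+ 2))))//.
apply: measurableT_comp.
  by apply: continuous_measurable_fun; exact: sqrt_continuous.
apply: (@measurable_fun_cvg _ _ _ _
    (fun n x => \sum_(0 <= k < n) f x k ^+ 2)).
- move=> n; apply: measurable_sum => k.
  exact: measurable_funX.
- by move=> x Dx; exact: (@l2_cvg R (f x)).
Qed.

Lemma coord_measurableB D f g : coord_measurable D f -> coord_measurable D g ->
  coord_measurable D (fun x => f x - g x).
Proof. by move=> mf mg k; exact: measurable_funB (mf k) (mg k). Qed.

Lemma coord_measurableZ D (h : T -> R) f :
  measurable_fun D h -> coord_measurable D f ->
  coord_measurable D (fun x => h x *: f x).
Proof. by move=> mh mf k; exact: measurable_funM mh (mf k). Qed.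

Lemma coord_measurable_cst D (v : l2 R) : coord_measurable D (fun=> v).
Proof. by move=> k; exact: measurable_cst. Qed.

Lemma coord_measurable_sum D I (s : seq I) (P : pred I) (F : I -> T -> l2 R) :
  (forall i, P i -> coord_measurable D (F i)) ->
  coord_measurable D (fun x => \sum_(i <- s | P i) F i x).
Proof.
move=> mF k; under eq_fun do rewrite l2_coord_sum.
under eq_fun do rewrite big_mkcond/=.
apply: measurable_sum => i; case: (boolP (P i)) => Pi; first exact: mF.
exact: measurable_cst.
Qed.

Lemma coord_measurable_cvg D (F : nat -> T -> l2 R) f :
  (forall n, coord_measurable D (F n)) ->
  (forall x, D x -> F n x @[n --> \oo] --> f x) -> coord_measurable D f.
Proof.
move=> mF Ff k; apply: (@measurable_fun_cvg _ _ _ _ (fun n x => F n x k)).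
  by move=> n; exact: mF.
by move=> x Dx; apply: l2_coord_cvg; exact: Ff.
Qed.

Lemma coord_measurable_subset D E f : measurable E -> D `<=` E ->
  coord_measurable E f -> coord_measurable D f.
Proof. by move=> mE DE mf k; exact: measurable_funS (mf k). Qed.

End coord_measurable.

(** The Cauchy-Schwarz inequality for finitely many coordinates. *)
Lemma sum_mul_le_l2_norm (R : realType) (w : nat -> R) (n : nat) (x : l2 R) :
  \sum_(0 <= k < n) w k * x k <=
  Num.sqrt (\sum_(0 <= k < n) w k ^+ 2) * `|x|.
Proof.
set S := \sum_(0 <= k < n) w k ^+ 2.
have S0 : 0 <= S by apply: sumr_ge0 => k _; exact: sqr_ge0.
have [->|x0] := eqVneq x 0.
  by rewrite normr0 mulr0 big1// => k _; rewrite mulr0.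
have {}x0 : 0 < `|x| by rewrite normr_gt0.
have [S00|Sn0] := eqVneq S 0.
  rewrite S00 sqrtr0 mul0r big_nat big1// => k /andP[_ kn].
  suff /eqP -> : w k == 0 by rewrite mul0r.
  rewrite -[_ == 0](expf_eq0 _ 2) eq_le sqr_ge0 andbT -S00 /S.
  by rewrite (bigD1_seq k) ?mem_index_iota ?iota_uniq//= lerDl sumr_ge0// =>
    i _; exact: sqr_ge0.
have s0 : 0 < Num.sqrt S by rewrite sqrtr_gt0 lt_neqAle eq_sym Sn0.
set s := Num.sqrt S in s0 *; set r := `|x|.
have sr0 : 0 < 2 * (s * r) by rewrite !mulr_gt0.
rewrite -(ler_pM2l sr0) mulr_sumr.
apply: (@le_trans _ _ (r ^+ 2 * S + s ^+ 2 * \sum_(0 <= k < n) x k ^+ 2)).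
  rewrite !mulr_sumr -big_split/=; apply: ler_sum => k _; rewrite -subr_ge0.
  rewrite (_ : _ - _ = (r * w k - s * x k) ^+ 2) ?sqr_ge0//; ring.
have -> : S = s ^+ 2 by rewrite sqr_sqrtr.
have := ler_wpM2l (sqr_ge0 s) (l2_sum_sqr_le x n).
rewrite -/r; lra.
Qed.

Section weak_integral.
Context d (T : measurableType d) (R : realType).
Variable mu : {measure set T -> \bar R}.
Implicit Types (D : set T) (f g : T -> l2 R).

(** [v] is the coordinatewise integral of [f]. Where a coordinate is not
    integrable the real-valued integral has a default value, so this is used
    together with [norm_integrable]. *)
Definition weak_integral D f (v : l2 R) :=
  forall k, v k = \int[mu]_(x in D) f x k.

(** Coordinatewise measurable, with integrable norm. *)
Definition norm_integrable D f :=
  coord_measurable D f /\ (\int[mu]_(x in D) (`|f x|)%:E < +oo)%E.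

Lemma norm_integrableP D f : norm_integrable D f ->
  mu.-integrable D (EFin \o (fun x => `|f x|)).
Proof.
move=> [mf fi]; apply/integrableP; split.
  by apply/measurable_EFinP; exact: coord_measurable_norm.
by under eq_integral do rewrite /= normr_id.
Qed.

Lemma norm_integrable_coord D f k : measurable D -> norm_integrable D f ->
  mu.-integrable D (EFin \o (fun x => f x k)).
Proof.
move=> mD fi; have := norm_integrableP fi.
apply: le_integrable => //.
  by apply/measurable_EFinP; exact: fi.1.
by move=> x Dx /=; rewrite lee_fin normr_id l2_coord_le.
Qed.

Lemma le_norm_integrable D f (g : T -> R) : measurable D ->
  coord_measurable D f -> mu.-integrable D (EFin \o g) ->
  (forall x, D x -> `|f x| <= g x) -> norm_integrable D f.
Proof.
move=> mD mf /integrableP[mg gi] fg; split => //.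
apply: le_lt_trans gi; apply: ge0_le_integral => //.
- by apply/measurable_EFinP; exact: coord_measurable_norm.
- exact: measurableT_comp.
- by move=> x Dx; rewrite lee_fin (le_trans (fg _ Dx))// ler_norm.
Qed.

Lemma norm_integrableB D f g : measurable D ->
  norm_integrable D f -> norm_integrable D g ->
  norm_integrable D (fun x => f x - g x).
Proof.
move=> mD fi gi.
apply: (@le_norm_integrable _ _ (fun x => `|f x| + `|g x|)) => //.
- exact: coord_measurableB fi.1 gi.1.
- apply: eq_integrable (integrableD mD (norm_integrableP fi) (norm_integrableP
    gi)) => //.
- by move=> x _; exact: ler_normB.
Qed.

Lemma weak_integralB D f g v w : measurable D ->
  norm_integrable D f -> norm_integrable D g ->
  weak_integral D f v -> weak_integral D g w ->
  weak_integral D (fun x => f x - g x) (v - w).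
Proof.
move=> mD fi gi fv gw k; rewrite l2_coordB fv gw.
by rewrite -RintegralB//; exact: norm_integrable_coord.
Qed.

(** With w the vector of the first n integrals, the squared norm of w is the
    integral of the scalar product of w and f, at most |w| times the integral of
    |f|. *)
Lemma sum_sqr_integral_le D f n : measurable D -> norm_integrable D f ->
  \sum_(0 <= k < n) (\int[mu]_(x in D) f x k) ^+ 2 <=
  (\int[mu]_(x in D) `|f x|) ^+ 2.
Proof.
move=> mD fi; pose w k := \int[mu]_(x in D) f x k.
set S := \sum_(0 <= k < n) _; set J := Rintegral _ _ _.
have S0 : 0 <= S by apply: sumr_ge0 => k _; exact: sqr_ge0.
have J0 : 0 <= J by apply: Rintegral_ge0.
have cfi k : mu.-integrable D (EFin \o (fun x => w k * f x k)).
  exact: (integrableZl mD (w k) (norm_integrable_coord k mD fi)).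
suff : Num.sqrt S ^+ 2 <= Num.sqrt S * J.
  rewrite -{3}(sqr_sqrtr S0).
  have := sqrtr_ge0 S; set s := Num.sqrt S => s0.
  have [->|sn0] := eqVneq s 0; first by rewrite expr0n sqr_ge0.
  rewrite expr2 ler_pM2l ?lt_neqAle ?(eq_sym 0) ?sn0// => sJ.
  by rewrite -expr2 lerXn2r.
rewrite sqr_sqrtr//.
have SE : S = \int[mu]_(x in D) \sum_(0 <= k < n) w k * f x k.
  rewrite /S /Rintegral.
  under [in RHS]eq_integral do rewrite -sumEFin.
  rewrite (integral_sum mD cfi) -sum_fine; last first.
    by move=> k _; exact: (integrable_fin_num mD (cfi k)).
  apply: eq_bigr => k _.
  by rewrite expr2 -RintegralZl//; exact: norm_integrable_coord.
rewrite {1}SE -RintegralZl//; last exact: norm_integrableP.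
apply: le_Rintegral => //.
- rewrite (_ : _ \o _ = (fun x => \sum_(0 <= k < n) (w k * f x k)%:E)%E).
    by apply: integrable_sum => // k _; exact: cfi.
  by apply/funext => x /=; rewrite sumEFin.
- exact: (integrableZl mD (Num.sqrt S) (norm_integrableP fi)).
- by move=> x _; exact: sum_mul_le_l2_norm.
Qed.

Lemma weak_integral_exists D f : measurable D -> norm_integrable D f ->
  exists v, weak_integral D f v.
Proof. by move=> mD fi; apply: l2_intro => n; exact: sum_sqr_integral_le. Qed.

Lemma weak_integral_norm D f v : measurable D -> norm_integrable D f ->
  weak_integral D f v -> `|v| <= \int[mu]_(x in D) `|f x|.
Proof.
move=> mD fi fv; apply: l2_norm_le; first exact: Rintegral_ge0.
by move=> n; under eq_bigr do rewrite fv; exact: sum_sqr_integral_le.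
Qed.

Lemma weak_integral_normB D f g v w : measurable D ->
  norm_integrable D f -> norm_integrable D g ->
  weak_integral D f v -> weak_integral D g w ->
  ((`|v - w|)%:E <= \int[mu]_(x in D) (`|f x - g x|)%:E)%E.
Proof.
move=> mD fi gi fv gw.
have fgi := norm_integrableB mD fi gi.
rewrite -(fineK (integrable_fin_num mD (norm_integrableP fgi))) lee_fin.
exact: weak_integral_norm (weak_integralB mD fi gi fv gw).
Qed.

Lemma norm_dominated_cvg D (F : nat -> T -> l2 R) f (h : T -> R) :
  measurable D -> (forall n, coord_measurable D (F n)) ->
    coord_measurable D f ->
  (forall x, D x -> F n x @[n --> \oo] --> f x) ->
  mu.-integrable D (EFin \o h) ->
  (forall n x, D x -> `|f x - F n x| <= h x) ->
  (\int[mu]_(x in D) (`|f x - F n x|)%:E)%E @[n --> \oo] --> (0 : \bar R)%E.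
Proof.
move=> mD mF mf Ff hi Fh.
have [] := @dominated_convergence _ _ _ mu D mD
  (fun n x => (`|f x - F n x|)%:E) (cst 0%E) (EFin \o h).
- move=> n; apply/measurable_EFinP; apply: coord_measurable_norm.
  exact: coord_measurableB.
- exact: measurable_cst.
- apply: aeW => x Dx; apply/fine_cvgP; split; first exact: nearW.
  apply/cvgrPdist_lt => e e0.
  move/cvgrPdist_lt : (Ff x Dx) => /(_ _ e0); apply: filterS => n /=.
  by rewrite sub0r normrN normr_id.
- exact: hi.
- by apply: aeW => x n Dx /=; rewrite lee_fin normr_id Fh.
by move=> _ _; rewrite integral0.
Qed.

Lemma weak_integral_dominated_cvg D (F : nat -> T -> l2 R) f (h : T -> R)
    (V : nat -> l2 R) v : measurable D ->
  (forall n, coord_measurable D (F n)) ->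
  (forall x, D x -> F n x @[n --> \oo] --> f x) ->
  mu.-integrable D (EFin \o h) ->
  (forall n x, D x -> `|F n x| <= h x) -> (forall x, D x -> `|f x| <= h x) ->
  (forall n, weak_integral D (F n) (V n)) -> weak_integral D f v ->
  V n @[n --> \oo] --> v.
Proof.
move=> mD mF Ff hi Fh fh FV fv.
have mf : coord_measurable D f := coord_measurable_cvg mF Ff.
have fi : norm_integrable D f := le_norm_integrable mD mf hi fh.
have Fi n : norm_integrable D (F n) := le_norm_integrable mD (mF n) hi (Fh n).
have h2i : mu.-integrable D (EFin \o (fun x => h x + h x)).
  exact: eq_integrable (integrableD mD hi hi).
have : (\int[mu]_(x in D) (`|f x - F n x|)%:E)%E @[n --> \oo] --> (0 : \bar
  R)%E.
  apply: norm_dominated_cvg h2i _ => // n x Dx.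
  by rewrite (le_trans (ler_normB _ _))// lerD ?fh ?Fh.
move=> /fine_cvgP[_ /cvgrPdist_lt H]; apply/cvgrPdist_lt => e e0.
apply: filterS (H _ e0) => n /=; rewrite sub0r normrN.
apply: le_lt_trans.
apply: le_trans (ler_norm _).
rewrite -lee_fin fineK; last first.
  exact: (integrable_fin_num mD (norm_integrableP (norm_integrableB mD fi (Fi
    n)))).
exact: weak_integral_normB.
Qed.

End weak_integral.

(** * The Bochner integral as a coordinatewise integral *)

Section simple_functions.
Context d (T : measurableType d) (R : realType).
Variable mu : {measure set T -> \bar R}.
Implicit Types (D : set T) (f : T -> l2 R).

Lemma integrable_indicZ D (A : set T) (c : R) : measurable D -> measurable A ->
  (mu (D `&` A) < +oo)%E -> mu.-integrable D (EFin \o (fun x => \1_A x * c)).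
Proof.
move=> mD mA muA; rewrite (_ : _ \o _ = fun x => (c%:E * (\1_A x)%:E)%E).
  apply: integrableZl => //; apply/integrableP; split.
    by apply/measurable_EFinP; exact: measurable_indic.
  under eq_integral do rewrite /= ger0_norm//.
  by rewrite integral_indic// setIC.
by apply/funext => x /=; rewrite -EFinM mulrC.
Qed.

Lemma Rintegral_indicZ D (A : set T) (c : R) : measurable D -> measurable A ->
  (mu (D `&` A) < +oo)%E ->
  \int[mu]_(x in D) (\1_A x * c) = fine (mu (D `&` A)) * c.
Proof.
move=> mD mA muA; rewrite /Rintegral.
under eq_integral do rewrite mulrC EFinM.
rewrite integralZl//; last first.
  have := integrable_indicZ 1 mD mA muA.
  by apply: eq_integrable => // x _ /=; rewrite mulr1.
rewrite integral_indic// setIC fineM//; last first.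
  by rewrite ge0_fin_numE.
by rewrite mulrC.
Qed.

(** The pieces of the simple function have finite measure in [D]. *)
Definition finite_simple D (s : simple_fun T (l2 R)) :=
  forall k, (mu (D `&` sf_set s k) < +oo)%E.

Lemma sf_fun_coord (s : simple_fun T (l2 R)) x k :
  sf_fun s x k = \sum_j \1_(sf_set s j) x * sf_val s j k.
Proof. by rewrite /sf_fun l2_coord_sum. Qed.

Lemma finite_simple_norm_integrable D s : measurable D -> finite_simple D s ->
  norm_integrable mu D (sf_fun s).
Proof.
move=> mD fs.
have ms j : measurable (sf_set s j) by exact: sf_measurable.
apply: (@le_norm_integrable _ _ _ _ _ _
  (fun x => \sum_j \1_(sf_set s j) x * `|sf_val s j|)) => //.
- apply: coord_measurable_sum => j _; apply: coord_measurableZ.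
    exact: measurable_indic.
  exact: coord_measurable_cst.
- rewrite (_ : _ \o _ =
      fun x => (\sum_j (\1_(sf_set s j) x * `|sf_val s j|)%:E)%E).
    apply: integrable_sum => // j _.
    exact: (integrable_indicZ `|sf_val s j| mD (ms j) (fs j)).
  by apply/funext => x /=; rewrite sumEFin.
- move=> x Dx; apply: le_trans (ler_norm_sum _ _ _) _.
  by apply: ler_sum => j _; rewrite normrZ ger0_norm.
Qed.

Lemma finite_simple_weak_integral D s : measurable D -> finite_simple D s ->
  weak_integral mu D (sf_fun s) (sf_integral mu D s).
Proof.
move=> mD fs k; rewrite /sf_integral l2_coord_sum.
have ms j : measurable (sf_set s j) by exact: sf_measurable.
rewrite /Rintegral.
under [in RHS]eq_integral do rewrite sf_fun_coord -sumEFin.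
have ci j := integrable_indicZ (sf_val s j k) mD (ms j) (fs j).
rewrite (integral_sum mD ci) -sum_fine; last first.
  by move=> j _; exact: (integrable_fin_num mD (ci j)).
by apply: eq_bigr => j _; rewrite -/(Rintegral _ _ _) Rintegral_indicZ.
Qed.

(** Functions that have a representation as a simple function with pieces of
    finite measure. *)
Definition simple_on D f := exists2 s : simple_fun T (l2 R),
  finite_simple D s & forall x, sf_fun s x = f x.

Lemma simple_on0 D : simple_on D (fun=> 0).
Proof.
exists (@SimpleF _ T R (l2 R) 0 (fun=> set0) (fun=> 0) (fun=> measurable0)).
  by case.
by move=> x; rewrite /sf_fun big_ord0.
Qed.

Lemma simple_onD D f g : simple_on D f -> simple_on D g ->
  simple_on D (fun x => f x + g x).
Proof.
move=> [s fs sE] [t ft tE].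
pose A (k : 'I_(sf_size s + sf_size t)) :=
  match fintype.split k with inl i => sf_set s i | inr j => sf_set t j end.
pose v (k : 'I_(sf_size s + sf_size t)) :=
  match fintype.split k with inl i => sf_val s i | inr j => sf_val t j end.
have mA k : measurable (A k).
  by rewrite /A; case: fintype.split => i; exact: sf_measurable.
exists (SimpleF v mA).
  by move=> k; rewrite /= /A; case: fintype.split => i.
move=> x; rewrite /sf_fun/= big_split_ord/= -sE -tE; congr (_ + _).
  by apply: eq_bigr => i _; rewrite /A /v (unsplitK (inl i)).
by apply: eq_bigr => i _; rewrite /A /v (unsplitK (inr i)).
Qed.

Lemma simple_on_sum D I (r : seq I) (F : I -> T -> l2 R) :
  (forall i, simple_on D (F i)) ->
  simple_on D (fun x => \sum_(i <- r) F i x).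
Proof.
move=> sF; elim: r => [|i r IH].
  by under eq_fun do rewrite big_nil; exact: simple_on0.
by under eq_fun do rewrite big_cons; exact: simple_onD.
Qed.

Lemma simple_on_indic D (A : set T) v : measurable A ->
  (mu (D `&` A) < +oo)%E -> simple_on D (fun x => (\1_A x : R) *: v).
Proof.
move=> mA muA.
exists (@SimpleF _ T R (l2 R) 1 (fun=> A) (fun=> v) (fun=> mA)) => //.
by move=> x; rewrite /sf_fun big_ord1.
Qed.

Import HBNNSimple.

Lemma simple_on_nnsfun D (p : {nnsfun T >-> R}) v : measurable D ->
  (\int[mu]_(x in D) (p x)%:E < +oo)%E -> simple_on D (fun x => p x *: v).
Proof.
move=> mD pfin.
under eq_fun do rewrite fimfunE fsbig_finite//= scaler_suml.
apply: simple_on_sum => r.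
(* The level set of 0 may have infinite measure, but contributes nothing. *)
have [->|r0] := eqVneq r 0.
  by under eq_fun do rewrite mul0r scale0r; exact: simple_on0.
under eq_fun do rewrite mulrC -scalerA.
apply: simple_on_indic => //.
have [[x px]|npx] := pselect (exists x, p x = r); last first.
  rewrite (_ : _ `&` _ = set0) ?measure0//.
  by rewrite -subset0 => x [_ /= pxr]; apply: npx; exists x.
have {}r0 : 0 < r by rewrite lt_neqAle eq_sym r0 -px; exact: fun_ge0.
have mr : measurable (p @^-1` [set r]) by [].
rewrite -(@lte_pmul2l _ r%:E) ?lte_fin//.
rewrite setIC -integral_indic// gt0_muley ?lte_fin//.
rewrite -ge0_integralZl//; last 2 first.
- by apply/measurable_EFinP; exact: measurable_indic.
- by rewrite lee_fin ltW.
apply: le_lt_trans pfin; apply: ge0_le_integral => //.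
- by move=> y _; rewrite mule_ge0// lee_fin ltW.
- by apply: measurable_funeM; apply/measurable_EFinP; exact: measurable_indic.
- by apply/measurable_EFinP; exact: measurable_funTS.
move=> y _; rewrite -EFinM lee_fin indicE.
have [/set_mem/= ->|_] := boolP (y \in _); first by rewrite mulr1.
by rewrite mulr0.
Qed.

End simple_functions.

Section bochner.
Context d (T : measurableType d) (R : realType).
Variable mu : {measure set T -> \bar R}.
Implicit Types (D : set T) (f g : T -> l2 R).

(** Replacing the integrand almost everywhere by a measurable one does not
    change the integrals of the distances, even if the original one is not
    measurable. *)
Lemma ae_eq_integral_norm D f g h : measurable D ->
  coord_measurable D g -> coord_measurable D h ->
  {ae mu, forall x, D x -> f x = g x} ->
  (\int[mu]_(x in D) (`|f x - h x|)%:E = \int[mu]_(x in D) (`|g x - h x|)%:E)%E.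
Proof.
move=> mD mg mh [N [mN N0 fgN]].
have mgh : measurable_fun D (fun x => (`|g x - h x|)%:E).
  apply/measurable_EFinP; apply: coord_measurable_norm.
  exact: coord_measurableB.
have fgE x : D x -> ~ N x -> f x = g x.
  by move=> Dx Nx; apply: contrapT => fg; apply: Nx; apply: fgN => /= /(_ Dx).
apply/eqP; rewrite eq_le; apply/andP; split.
  (* The distance to f is bounded by the measurable function that is +oo on the
     exceptional set N. *)
  pose e x := if x \in N then +oo%E else (`|g x - h x|)%:E.
  have me : measurable_fun D e.
    apply: measurable_fun_if => //.
    - apply: (@measurable_fun_bool _ _ _ _ true).
      rewrite (_ : _ @^-1` _ = N) ?setTI//; first exact: measurableI.
      by apply/seteqP; split => [x /= /set_mem|x /= Nx]//; exact/mem_set.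
    - by apply: measurable_funS mgh => //; exact: subIsetl.
  have eE : (\int[mu]_(x in D) e x = \int[mu]_(x in D) (`|g x - h x|)%:E)%E.
    apply: (ge0_ae_eq_integral mD me mgh) => //.
      by move=> x _; rewrite /e; case: ifPn.
    exists N; split => // x /= ex; apply: contrapT => Nx; apply: ex => Dx.
    by rewrite /e memNset.
  apply: (@le_trans _ _ (\int[mu]_(x in D) e x)%E); last by rewrite eE.
  apply: le_lower_integral => //.
    by move=> x _; rewrite /e; case: ifPn.
  move=> x Dx; split => //; rewrite /e; case: ifPn; first by rewrite leey.
  by move=> /negP Nx; rewrite fgE// => /mem_set.
have gE : (\int[mu]_(x in D) (`|g x - h x|)%:E =
    \int[mu]_(x in D `\` N) (`|g x - h x|)%:E)%E.
  by apply: ge0_negligible_integral.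
apply: (@le_trans _ _ (\int[mu]_(x in D `\` N) (`|g x - h x|)%:E)%E).
  by rewrite gE.
apply: le_lower_integral; [by []|by []|].
by move=> x [Dx Nx]; rewrite fgE.
Qed.

Lemma is_bochner_integral_ae D f g v : measurable D -> coord_measurable D g ->
  {ae mu, forall x, D x -> f x = g x} ->
  is_bochner_integral mu D f v <-> is_bochner_integral mu D g v.
Proof.
move=> mD mg fg.
have H (s : nat -> simple_fun T (l2 R)) :
    (forall n, finite_simple mu D (s n)) ->
    (fun n => \int[mu]_(x in D) (`|f x - sf_fun (s n) x|)%:E)%E =
    (fun n => \int[mu]_(x in D) (`|g x - sf_fun (s n) x|)%:E)%E.
  move=> fs; apply/funext => n; apply: ae_eq_integral_norm => //.
  exact: (finite_simple_norm_integrable mD (fs n)).1.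
split=> -[s [fs sf i0 sv]]; exists s; split; [exact: fs| | |exact: sv|
                                             exact: fs| | |exact: sv].
- apply: filterS2 fg sf => x fgx sfx Dx.
  by rewrite -(fgx Dx); exact: sfx.
- by rewrite -(H s fs); exact: i0.
- apply: filterS2 fg sf => x fgx sfx Dx.
  by rewrite (fgx Dx); exact: sfx.
- by rewrite (H s fs); exact: i0.
Qed.

Lemma bochner_weak_integral D f v : measurable D -> norm_integrable mu D f ->
  is_bochner_integral mu D f v -> weak_integral mu D f v.
Proof.
move=> mD fi [s [fs _ i0 sv]].
have [w fw] := weak_integral_exists mD fi.
suff : sf_integral mu D (s n) @[n --> \oo] --> w.
  by move=> sw; rewrite (cvg_unique (@norm_hausdorff _ _) sv sw).
move/fine_cvgP : i0 => [_ /cvgrPdist_lt H]; apply/cvgrPdist_lt => e e0.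
apply: filterS (H _ e0) => n /=; rewrite sub0r normrN.
apply: le_lt_trans; apply: le_trans (ler_norm _).
have si := finite_simple_norm_integrable mD (fs n).
rewrite -lee_fin fineK; last first.
  exact: (integrable_fin_num mD (norm_integrableP (norm_integrableB mD fi si))).
apply: weak_integral_normB => //; exact: finite_simple_weak_integral.
Qed.

Import HBNNSimple.

(** Each coordinate is approximated by simple functions, and the n-th
    approximation uses the first n coordinates. *)
Lemma norm_integrable_simple_approx D f : measurable D ->
  norm_integrable mu D f ->
  exists s : nat -> simple_fun T (l2 R),
    [/\ forall n, finite_simple mu D (s n),
        forall x, D x -> sf_fun (s n) x @[n --> \oo] --> f x &
        forall n x, D x -> `|f x - sf_fun (s n) x| <= `|f x|].
Proof.
move=> mD fi.
have mF k : measurable_fun D (EFin \o (fun x => f x k)).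
  by apply/measurable_EFinP; exact: fi.1.
pose P k := nnsfun_approx mD (measurable_funepos (mF k)).
pose M k := nnsfun_approx mD (measurable_funeneg (mF k)).
pose a n x : l2 R := \sum_(0 <= k < n)
  (P k n x *: unit_vector R k + M k n x *: (- unit_vector R k)).
have Ple k n x : D x -> ((P k n x)%:E <= (EFin \o (fun x => f x k))^\+ x)%E.
  by move=> Dx; rewrite /P nnsfun_approxE le_approx.
have Mle k n x : D x -> ((M k n x)%:E <= (EFin \o (fun x => f x k))^\- x)%E.
  by move=> Dx; rewrite /M nnsfun_approxE le_approx.
have sa n : simple_on mu D (a n).
  apply: simple_on_sum => k; apply: simple_onD; apply: simple_on_nnsfun => //.
    apply: le_lt_trans (integral_funepos_lt_pinfty mD (norm_integrable_coord k
      mD fi)).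
    apply: ge0_le_integral => //.
    - by move=> x _; rewrite lee_fin; exact: fun_ge0.
    - by apply/measurable_EFinP; exact: measurable_funTS.
    - exact: measurable_funepos.
    - by move=> x Dx; exact: Ple.
  apply: le_lt_trans (integral_funeneg_lt_pinfty mD (norm_integrable_coord k
    mD fi)).
  apply: ge0_le_integral => //.
  - by move=> x _; rewrite lee_fin; exact: fun_ge0.
  - by apply/measurable_EFinP; exact: measurable_funTS.
  - exact: measurable_funeneg.
  - by move=> x Dx; exact: Mle.
have /choice[s sP] : forall n, exists s : simple_fun T (l2 R),
    finite_simple mu D s /\ (forall x, sf_fun s x = a n x).
  by move=> n; have [s fs sE] := sa n; exists s.
have aE n x k : a n x k = if (k < n)%N then P k n x - M k n x else 0.
  rewrite /a l2_coord_sum.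
  have E i : (P i n x *: unit_vector R i + M i n x *: - unit_vector R i) k =
      if k == i then P i n x - M i n x else 0.
    rewrite -[LHS]/(P i n x * (k == i)%:R + M i n x * - (k == i)%:R).
    by case: eqP => _; rewrite ?mulr1 ?mulrN1// oppr0 !mulr0 addr0.
  under eq_bigr do rewrite E.
  case: ifPn => kn.
    rewrite (bigD1_seq k)/= ?iota_uniq ?mem_index_iota//.
    by rewrite eqxx big1 ?addr0// => i /negPf; rewrite eq_sym => ->.
  rewrite big_nat big1// => i /andP[_ il]; case: eqP => // ki.
  by move: kn; rewrite ki il.
have fE x k : f x k = fine ((EFin \o (fun x => f x k))^\+ x) -
    fine ((EFin \o (fun x => f x k))^\- x).
  rewrite funeposE funenegE /= -!EFin_max /=.
  have [fk|/ltW fk] := leP 0 (f x k).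
    by rewrite max_r ?oppr_le0// subr0.
  by rewrite max_l ?oppr_ge0// sub0r opprK.
have afd n x k : D x -> `|f x k - a n x k| <= `|f x k|.
  move=> Dx; rewrite aE; case: ifPn => kn; last by rewrite subr0.
  have := Ple k n x Dx; have := Mle k n x Dx.
  have P0 : 0 <= P k n x by []. have M0 : 0 <= M k n x by [].
  rewrite funeposE funenegE /= -!EFin_max !lee_fin /=.
  have [fk|fk] := leP 0 (f x k).
    rewrite max_r ?oppr_le0// => M0' PF.
    by rewrite (ger0_norm fk) ler_norml; apply/andP; split; lra.
  rewrite max_l ?oppr_ge0 ?(ltW fk)// => M0' PF.
  by rewrite (ltr0_norm fk) ler_norml; apply/andP; split; lra.
exists s; split.
- by move=> n; exact: (sP n).1.
- move=> x Dx; under eq_fun do rewrite (sP _).2.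
  apply: l2_cvg_dominated => k; last first.
    by move=> k'; exact: afd.
  have -> : f x k = fine ((EFin \o (fun x => f x k))^\+ x) -
    fine ((EFin \o (fun x => f x k))^\- x) by exact: fE.
  apply: (cvg_trans _ (cvgB (_ : P k n x @[n --> \oo] --> _)
                            (_ : M k n x @[n --> \oo] --> _))).
  + apply: near_eq_cvg; exists k.+1 => // n /= kn.
    by rewrite aE kn.
  + rewrite /P; under eq_fun do rewrite nnsfun_approxE.
    by apply: cvg_approx => //; rewrite funeposE /= -EFin_max ltry.
  + rewrite /M; under eq_fun do rewrite nnsfun_approxE.
    by apply: cvg_approx => //; rewrite funenegE /= -EFin_max ltry.
- move=> n x Dx; rewrite (sP n).2; apply: l2_norm_le => // m.
  apply: le_trans (l2_sum_sqr_le (f x) m); apply: ler_sum => k _.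
  rewrite -[leLHS]real_normK ?num_real// -[leRHS]real_normK ?num_real//.
  by rewrite lerXn2r ?nnegrE ?normr_ge0//; exact: afd.
Qed.

Lemma weak_bochner_integral D f v : measurable D -> norm_integrable mu D f ->
  weak_integral mu D f v -> is_bochner_integral mu D f v.
Proof.
move=> mD fi fv.
have [s [fs sf sd]] := norm_integrable_simple_approx mD fi.
have si n := finite_simple_norm_integrable mD (fs n).
have i0 : (\int[mu]_(x in D) (`|f x - sf_fun (s n) x|)%:E)%E @[n --> \oo]
    --> (0 : \bar R)%E.
  apply: (norm_dominated_cvg mD _ fi.1 sf (norm_integrableP fi) sd).
  by move=> n; exact: (si n).1.
exists s; split => //; first exact: aeW.
move/fine_cvgP : i0 => [_ /cvgrPdist_lt H]; apply/cvgrPdist_lt => e e0.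
apply: filterS (H _ e0) => n /=; rewrite sub0r normrN.
apply: le_lt_trans; apply: le_trans (ler_norm _).
rewrite -lee_fin fineK; last first.
  exact: (integrable_fin_num mD (norm_integrableP (norm_integrableB mD fi (si
    n)))).
apply: weak_integral_normB => //; exact: finite_simple_weak_integral.
Qed.

(** The Bochner integral of a function that is almost everywhere equal to an
    integrable one is the coordinatewise integral. *)
Lemma bochner_weakP D f g v : measurable D -> norm_integrable mu D g ->
  {ae mu, forall x, D x -> f x = g x} ->
  is_bochner_integral mu D f v <-> weak_integral mu D g v.
Proof.
move=> mD gi fg; split => [/(is_bochner_integral_ae v mD gi.1 fg)|gv].
  exact: bochner_weak_integral.
by apply/(is_bochner_integral_ae v mD gi.1 fg); exact: weak_bochner_integral.
Qed.

End bochner.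

(** * Series with at most one nonzero term, finite sums of integrals *)

Section single_term_series.

Lemma sum_single (V : nmodType) (F : nat -> V) (P : pred nat) (i0 n : nat) :
  (forall i, P i -> i != i0 -> F i = 0) -> (i0 < n)%N ->
  \sum_(0 <= i < n | P i) F i = if P i0 then F i0 else 0.
Proof.
move=> F0 i0n; rewrite big_mkcond/= (bigD1_seq i0)/= ?iota_uniq
  ?mem_index_iota//.
rewrite big1 ?addr0// => i ii0; case: ifPn => // Pi; exact: F0.
Qed.

Lemma cvg_sum_single (R : numFieldType) (V : normedModType R) (F : nat -> V)
    (P : pred nat) (i0 : nat) :
  (forall i, P i -> i != i0 -> F i = 0) ->
  \sum_(0 <= i < n | P i) F i @[n --> \oo] --> (if P i0 then F i0 else 0).
Proof.
move=> F0; apply: cvg_near_cst; exists i0.+1 => // n /= i0n.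
exact: sum_single.
Qed.

Lemma lim_sum_single (R : numFieldType) (V : normedModType R) (F : nat -> V)
    (P : pred nat) (i0 : nat) :
  (forall i, P i -> i != i0 -> F i = 0) ->
  \sum_(i <oo | P i) F i = if P i0 then F i0 else 0.
Proof.
by move=> F0; apply: cvg_lim; [exact: norm_hausdorff|exact: cvg_sum_single].
Qed.

Lemma nneseries_single (R : realType) (F : nat -> \bar R)
    (P : pred nat) (i0 : nat) :
  (forall i, P i -> i != i0 -> F i = 0%E) ->
  (\sum_(i <oo | P i) F i = if P i0 then F i0 else 0)%E.
Proof.
move=> F0; apply: lim_near_cst => //; exists i0.+1 => // n /= i0n.
exact: sum_single.
Qed.

Lemma nneseries_term_le (R : realType) (F : nat -> \bar R) (P : pred nat) j :
  (forall i, P i -> 0 <= F i)%E -> P j -> (F j <= \sum_(i <oo | P i) F i)%E.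
Proof.
move=> F0 Pj; rewrite (nneseriesD1 (n := j))// leeDl//.
by apply: nneseries_ge0 => k _ /andP[Pk _]; exact: F0.
Qed.

End single_term_series.

Section weak_integral_sums.
Context d (T : measurableType d) (R : realType).
Variable mu : {measure set T -> \bar R}.
Variables (D : set T) (mD : measurable D).

Lemma norm_integrable_scale (h : T -> R) (v : l2 R) :
  mu.-integrable D (EFin \o h) -> norm_integrable mu D (fun x => h x *: v).
Proof.
move=> hi; apply: (@le_norm_integrable _ _ _ _ _ _ (fun x =>
  `|v| * `|h x|)) => //.
- apply: coord_measurableZ; last exact: coord_measurable_cst.
  by have /integrableP[/measurable_EFinP] := hi.
- exact: (integrableZl mD `|v| (integrable_norm hi)).
- by move=> x _; rewrite normrZ mulrC.
Qed.

Lemma weak_integral_scale (h : T -> R) (v : l2 R) :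
  mu.-integrable D (EFin \o h) ->
  weak_integral mu D (fun x => h x *: v) ((\int[mu]_(x in D) h x) *: v).
Proof. by move=> hi k; rewrite l2_coordZ -RintegralZr. Qed.

Lemma norm_integrable_sum I (s : seq I) (P : pred I) (F : I -> T -> l2 R) :
  (forall i, P i -> norm_integrable mu D (F i)) ->
  norm_integrable mu D (fun x => \sum_(i <- s | P i) F i x).
Proof.
move=> Fi.
apply: (@le_norm_integrable _ _ _ _ _ _ (fun x =>
  \sum_(i <- s | P i) `|F i x|)) => //.
- by apply: coord_measurable_sum => i Pi; exact: (Fi i Pi).1.
- rewrite (_ : _ \o _ = fun x => (\sum_(i <- s | P i) (`|F i x|)%:E)%E).
    by apply: integrable_sum => // i Pi; exact: (norm_integrableP (Fi i Pi)).
  by apply/funext => x /=; rewrite sumEFin.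
- by move=> x _; exact: ler_norm_sum.
Qed.

Lemma weak_integral_sum I (s : seq I) (P : pred I) (F : I -> T -> l2 R)
    (V : I -> l2 R) :
  (forall i, P i -> norm_integrable mu D (F i)) ->
  (forall i, P i -> weak_integral mu D (F i) (V i)) ->
  weak_integral mu D (fun x => \sum_(i <- s | P i) F i x)
    (\sum_(i <- s | P i) V i).
Proof.
move=> Fi FV; elim: s => [|i s IH] k.
  rewrite big_nil /Rintegral; under eq_integral do rewrite big_nil.
  by rewrite integral0.
rewrite big_cons; under eq_Rintegral do rewrite big_cons.
case: ifPn => Pi; last exact: IH.
rewrite -[LHS]/(V i k + (\sum_(j <- s | P j) V j) k) (FV _ Pi) (IH k).
rewrite -RintegralD//; [exact: norm_integrable_coord k mD (Fi _ Pi)|].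
exact: norm_integrable_coord k mD (norm_integrable_sum s Fi).
Qed.

End weak_integral_sums.

(** * The transitions and their sets in the plane *)

Section jump.
Context (R : realType) (Gamma : l2 R -> nat -> nat -> R).
Hypothesis Gamma_rate : forall q, simplex q -> rate_matrix (Gamma q).
Hypothesis rate_sup_fin : (rate_sup Gamma < +oo)%E.
Variables (q : l2 R) (Sq : simplex q).
Local Notation gamma := (fine (rate_sup Gamma)).
Local Notation A := (jump_set Gamma q).
Local Notation Q i j := (q i * Gamma q i j).
Local Notation mu2 := (@lebesgue2 R).

Lemma diag_rate_le i : `|Gamma q i i| <= gamma.
Proof.
have le_sup : ((`|Gamma q i i|)%:E <= rate_sup Gamma)%E.
  apply: (@le_trans _ _ (ereal_sup (range (fun i => (`|Gamma q i i|)%:E)))).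
    by apply: ereal_sup_ubound; exists i.
  by apply: ereal_sup_ubound; exists q.
rewrite -lee_fin fineK// fin_real// rate_sup_fin andbT.
by apply: lt_le_trans le_sup; rewrite ltNyr.
Qed.

Lemma rate_sup_ge0 : 0 <= gamma.
Proof. exact: le_trans (diag_rate_le 0). Qed.

Lemma offdiag_rate_ge0 i j : j != i -> 0 <= Gamma q i j.
Proof. by rewrite eq_sym => ij; exact: (Gamma_rate Sq).1. Qed.

Lemma offdiag_rate_sum_le i :
  (\sum_(j <oo | j != i) (Gamma q i j)%:E <= gamma%:E)%E.
Proof.
rewrite (Gamma_rate Sq).2 lee_fin; apply: le_trans (diag_rate_le i).
by rewrite -normrN ler_norm.
Qed.

Lemma offdiag_rate_le i j : j != i -> Gamma q i j <= gamma.
Proof.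
move=> ji; rewrite -lee_fin; apply: le_trans (offdiag_rate_sum_le i).
apply: (@nneseries_term_le _ (fun j => (Gamma q i j)%:E) (fun j => j != i)) =>
  //.
by move=> k ki; rewrite lee_fin offdiag_rate_ge0.
Qed.

Lemma simplex_ge0 i : 0 <= q i. Proof. exact: Sq.2. Qed.

Lemma simplex_le1 i : q i <= 1.
Proof.
rewrite -lee_fin -Sq.1.
apply: (@nneseries_term_le _ (fun i => (q i)%:E) xpredT) => //.
by move=> k _; rewrite lee_fin simplex_ge0.
Qed.

Lemma flux_ge0 i j : j != i -> 0 <= Q i j.
Proof. by move=> ji; rewrite mulr_ge0 ?simplex_ge0 ?offdiag_rate_ge0. Qed.

Lemma flux_le i j : j != i -> Q i j <= gamma.
Proof.
move=> ji; rewrite -[leRHS]mul1r ler_pM ?simplex_ge0 ?simplex_le1//.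
  exact: offdiag_rate_ge0.
exact: offdiag_rate_le.
Qed.

Lemma flux_sum_le : (\sum_(i <oo) \sum_(j <oo | j != i) (Q i j)%:E <=
  gamma%:E)%E.
Proof.
apply: (@le_trans _ _ (\sum_(i <oo) gamma%:E * (q i)%:E)%E).
  apply: lee_nneseries => i _.
    move=> _; apply: nneseries_ge0 => j _ ji.
    by rewrite lee_fin flux_ge0.
  under eq_eseriesr do rewrite EFinM.
  rewrite nneseriesZl; last by move=> j ji; rewrite lee_fin offdiag_rate_ge0.
  rewrite muleC; apply: lee_wpmul2r; first by rewrite lee_fin simplex_ge0.
  exact: offdiag_rate_sum_le.
by rewrite nneseriesZl ?Sq.1 ?mule1// => i _; rewrite lee_fin simplex_ge0.
Qed.

Lemma jump_setE i j : A i j =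
  `]i%:R, i.+1%:R] `*` `](j%:R * gamma), (j%:R * gamma + Q i j)].
Proof.
apply/seteqP; split => [y [_ y1 y2]|y [/= y1 y2]].
  by split; rewrite /= in_itv.
rewrite !in_itv /= in y1 y2.
split => //; split => /=; rewrite in_itv/= andbT.
  by case/andP: y1 => /ltW + _; apply: le_trans.
by case/andP: y2 => /ltW + _; apply: le_trans; rewrite mulr_ge0// rate_sup_ge0.
Qed.

Lemma measurable_jump_set i j :
  measurable (A i j : set (measurableTypeR R * measurableTypeR R)).
Proof. by rewrite jump_setE; apply: measurableX; exact: measurable_itv. Qed.

Lemma measure_jump_set i j : j != i -> mu2 (A i j) = (Q i j)%:E.
Proof.
move=> ji; rewrite jump_setE /lebesgue2 product_measure1E//=.
rewrite !lebesgue_measure_itv/= !lte_fin ltr_nat ltnSn.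
rewrite -EFinB -natr1 addrAC subrr add0r mul1e.
case: ifPn => [_|]; first by rewrite -EFinB addrAC subrr add0r.
rewrite -leNgt gerDl => Q0.
by congr EFin; apply/eqP; rewrite eq_le Q0 flux_ge0.
Qed.

(** The sets attached to distinct transitions are disjoint: a point of the
    plane belongs to the set of at most one transition, which is [c] if there is
    one. *)
Lemma jump_cell y : exists2 c : option (nat * nat),
  forall i j, j != i -> (\1_(A i j) y : R) = (c == Some (i, j))%:R &
  forall i j, c = Some (i, j) -> j != i.
Proof.
have [[[i j] [/= ji Ay]]|H] :=
    pselect (exists ij, ij.2 != ij.1 /\ A ij.1 ij.2 y).
  exists (Some (i, j)); last by move=> _ _ [<- <-].
  move=> k l lk; rewrite indicE; congr (_%:R); congr nat_of_bool.
  apply/idP/eqP => [/set_mem Ay'|[<- <-]]; last exact/mem_set.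
  (* The first coordinate of y determines i, and the second one determines j
     since no flux exceeds the supremum of the rates. *)
  case: Ay => _ /andP[iy yi] /andP[jy yj].
  case: Ay' => _ /andP[ky yk] /andP[ly yl].
  have ik : i = k.
    have := lt_le_trans iy yk; have := lt_le_trans ky yi.
    by rewrite !ltr_nat !ltnS => ? ?; apply/eqP; rewrite eqn_leq; apply/andP.
  congr (Some (_, _)) => //.
  have yj' : y.2 <= j.+1%:R * gamma.
    by rewrite -natr1 mulrDl mul1r (le_trans yj)// lerD2l flux_le.
  have yl' : y.2 <= l.+1%:R * gamma.
    by rewrite -natr1 mulrDl mul1r (le_trans yl)// lerD2l flux_le.
  have gam0 : 0 < gamma.
    rewrite lt_neqAle rate_sup_ge0 andbT; apply/eqP => g0.
    by move: (lt_le_trans jy yj'); rewrite -g0 !mulr0 ltxx.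
  have := lt_le_trans jy yl'; have := lt_le_trans ly yj'.
  rewrite !ltr_pM2r// !ltr_nat !ltnS => ? ?.
  by apply/eqP; rewrite eqn_leq; apply/andP.
exists None => // i j ji; rewrite indicE memNset// => Ay.
by apply: H; exists (i, j).
Qed.

(** A family of vectors indexed by the transitions, summed against the
    indicators of the sets of the transitions. *)
Definition cell_sum (V : normedModType R) (F : nat -> nat -> V)
    (y : R * R) : V :=
  \sum_(i <oo) \sum_(j <oo | j != i) (\1_(A i j) y : R) *: F i j.

(** The transitions from [i] only. *)
Definition cell_row (V : normedModType R) (F : nat -> nat -> V) (i : nat)
    (y : R * R) : V :=
  \sum_(j <oo | j != i) (\1_(A i j) y : R) *: F i j.

Lemma cell_rowE (V : normedModType R) (F : nat -> nat -> V) i y c :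
  (forall i j, j != i -> (\1_(A i j) y : R) = (c == Some (i, j))%:R) ->
  (forall i j, c = Some (i, j) -> j != i) ->
  cell_row F i y = if c is Some (k, l) then if i == k then F k l else 0 else 0.
Proof.
move=> cE cnz; rewrite /cell_row; case: c cE cnz => [[k l]|] cE cnz; last first.
  rewrite (@lim_sum_single _ _ _ _ 0); last first.
    by move=> j ji _; rewrite cE// scale0r.
  by case: ifPn => // i0; rewrite cE// scale0r.
have lk : l != k by exact: cnz.
rewrite (@lim_sum_single _ _ _ _ l); last first.
  move=> j ji jl; rewrite cE// (_ : _ == _ = false) ?scale0r//.
  by apply/eqP => -[_ lj]; rewrite lj eqxx in jl.
have [->|ik] := eqVneq i k; first by rewrite lk cE// eqxx scale1r.
case: ifPn => // li; rewrite cE// (_ : _ == _ = false) ?scale0r//.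
by apply/eqP => -[ki]; rewrite ki eqxx in ik.
Qed.

Lemma cvg_cell_row (V : normedModType R) (F : nat -> nat -> V) i y :
  \sum_(0 <= j < n | j != i) (\1_(A i j) y : R) *: F i j @[n --> \oo]
    --> cell_row F i y.
Proof.
have [c cE cnz] := jump_cell y.
pose l := if c is Some (_, l) then l else 0.
have H j : j != i -> j != l -> (\1_(A i j) y : R) *: F i j = 0.
  move=> ji jl; rewrite cE// (_ : _ == _ = false) ?scale0r//.
  by apply/eqP => oS; move: jl; rewrite /l oS eqxx.
rewrite /cell_row (lim_sum_single H); exact: cvg_sum_single.
Qed.

Lemma cvg_cell_sum (V : normedModType R) (F : nat -> nat -> V) y :
  \sum_(0 <= i < n) cell_row F i y @[n --> \oo] --> cell_sum F y.
Proof.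
have [c cE cnz] := jump_cell y.
pose k := if c is Some (k, _) then k else 0.
have H i : xpredT i -> i != k -> cell_row F i y = 0.
  move=> _; rewrite (cell_rowE _ _ cE cnz) /k.
  by case: c {cE cnz k} => [[k l]|//] /negPf ->.
rewrite /cell_sum (lim_sum_single H); exact: cvg_sum_single.
Qed.

Lemma cell_sumE (V : normedModType R) (F : nat -> nat -> V) y c :
  (forall i j, j != i -> (\1_(A i j) y : R) = (c == Some (i, j))%:R) ->
  (forall i j, c = Some (i, j) -> j != i) ->
  cell_sum F y = if c is Some (k, l) then F k l else 0.
Proof.
move=> cE cnz; pose k := if c is Some (k, _) then k else 0.
have H i : xpredT i -> i != k -> cell_row F i y = 0.
  move=> _; rewrite (cell_rowE _ _ cE cnz) /k.
  by case: c {cE cnz k} => [[k l]|//] /negPf ->.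
rewrite /cell_sum (lim_sum_single H) (cell_rowE _ _ cE cnz) /k.
by case: c {cE cnz k H} => [[k l]|//]; rewrite eqxx.
Qed.

Lemma nneseries_cell (F : nat -> nat -> \bar R) y c :
  (forall i j, j != i -> (\1_(A i j) y : R) = (c == Some (i, j))%:R) ->
  (forall i j, c = Some (i, j) -> j != i) ->
  (\sum_(i <oo) \sum_(j <oo | j != i) ((\1_(A i j) y)%:E * F i j) =
   if c is Some (k, l) then F k l else 0)%E.
Proof.
move=> cE cnz; case: c cE cnz => [[k l]|] cE cnz; last first.
  rewrite eseries0// => i _ _; rewrite eseries0// => j _ ji.
  by rewrite cE// mul0e.
have lk : l != k by exact: cnz.
have E i j : j != i -> (i, j) != (k, l) -> ((\1_(A i j) y)%:E * F i j = 0)%E.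
  move=> ji ijkl; rewrite cE// (_ : _ == _ = false) ?mul0e//.
  by apply/eqP => -[ki lj]; rewrite ki lj eqxx in ijkl.
rewrite (@nneseries_single _ _ _ k)/=; last first.
  move=> i _ ik; rewrite eseries0// => j _ ji; apply: E => //.
  by apply/eqP => -[ki _]; rewrite ki eqxx in ik.
rewrite (@nneseries_single _ _ _ l)/=; last first.
  move=> j jk jl; apply: E => //.
  by apply/eqP => -[lj]; rewrite lj eqxx in jl.
by rewrite lk cE// eqxx mul1e.
Qed.

End jump.

(** * Integrals over the plane at a fixed time *)

Lemma integral_nneseries2 d (T : measurableType d) (R : realType)
    (mu : {measure set T -> \bar R}) (P : nat -> pred nat)
    (F : nat -> nat -> T -> \bar R) :
  (forall i j, measurable_fun setT (F i j)) ->
  (forall i j x, P i j -> (0 <= F i j x)%E) ->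
  (\int[mu]_x (\sum_(i <oo) \sum_(j <oo | P i j) F i j x) =
   \sum_(i <oo) \sum_(j <oo | P i j) \int[mu]_x F i j x)%E.
Proof.
move=> mF F0.
pose G i j x := if P i j then F i j x else 0%E.
have mG i j : measurable_fun setT (G i j).
  by rewrite /G; case: (P i j) => //; exact: mF.
have G0 i j x : (0 <= G i j x)%E.
  by rewrite /G; case: ifPn => // Pij; exact: F0.
have E i x : (\sum_(j <oo | P i j) F i j x = \sum_(j <oo) G i j x)%E.
  by rewrite eseries_mkcond.
transitivity (\int[mu]_x (\sum_(i <oo) \sum_(j <oo) G i j x))%E.
  by apply: eq_integral => x _; apply: eq_eseriesr => i _; exact: E.
rewrite integral_nneseries//; last 2 first.
- by move=> i; apply: ge0_emeasurable_sum => //.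
- by move=> i x _; apply: nneseries_ge0.
apply: eq_eseriesr => i _.
rewrite integral_nneseries// [RHS]eseries_mkcond; apply: eq_eseriesr => j _.
by rewrite /G; case: (P i j) => //; rewrite integral0.
Qed.

Section jump_integrals.
Context (R : realType) (Gamma : l2 R -> nat -> nat -> R).
Hypothesis Gamma_rate : forall q, simplex q -> rate_matrix (Gamma q).
Hypothesis rate_sup_fin : (rate_sup Gamma < +oo)%E.
Variables (q : l2 R) (Sq : simplex q).
Local Notation gamma := (fine (rate_sup Gamma)).
Local Notation A := (jump_set Gamma q).
Local Notation Q i j := (q i * Gamma q i j).
Local Notation mu2 := (@lebesgue2 R).
Local Notation T2 := (measurableTypeR R * measurableTypeR R)%type.

Let jcell y := jump_cell Gamma_rate rate_sup_fin Sq y.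

Let mA i j : measurable (A i j : set T2).
Proof. exact: measurable_jump_set. Qed.

(** The points of the plane at which some jump occurs. *)
Definition jump_area : set (R * R) :=
  \bigcup_i \bigcup_(j in [set j | j != i]) A i j.

Lemma measurable_jump_area : measurable (jump_area : set T2).
Proof. by apply: bigcup_measurable => i _; apply: bigcup_measurable. Qed.

Lemma indic_jump_area y c :
  (forall i j, j != i -> (\1_(A i j) y : R) = (c == Some (i, j))%:R) ->
  (forall i j, c = Some (i, j) -> j != i) ->
  \1_jump_area y = if c is Some _ then 1 else 0 :> R.
Proof.
move=> cE cnz; rewrite indicE; case: c cE cnz => [[k l]|] cE cnz.
  rewrite mem_set//; have lk : l != k by exact: cnz.
  exists k => //; exists l => //.
  have := cE k l lk; rewrite eqxx indicE.
  by case: (boolP (y \in A k l)) => [/set_mem//|_ /eqP];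
    rewrite eq_sym oner_eq0.
rewrite memNset// => -[k _ [l /= lk Ay]].
by have /eqP := cE k l lk; rewrite indicE mem_set// oner_eq0.
Qed.

(** The area of the jumps is the sum of the fluxes. *)
Lemma measure_jump_area_le : (mu2 jump_area <= gamma%:E)%E.
Proof.
have mU := measurable_jump_area.
have E : (\int[mu2]_y (\sum_(i <oo) \sum_(j <oo | j != i)
      ((\1_(A i j) y)%:E * 1)) =
    \sum_(i <oo) \sum_(j <oo | j != i) (Q i j)%:E)%E.
  apply: etrans (integral_nneseries2 mu2 (P := fun i j => j != i) _ _) _.
  - move=> i j; apply: emeasurable_funM => //.
    by apply/measurable_EFinP; exact: measurable_indic.
  - by move=> i j y _; rewrite mule1 lee_fin.
  apply: eq_eseriesr => i _; apply: eq_eseriesr => j ji.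
  under eq_integral do rewrite mule1.
  rewrite integral_indic//.
  apply: etrans _ (measure_jump_set Gamma_rate rate_sup_fin Sq ji).
  by congr (lebesgue2 _); rewrite setIT.
suff H : mu2 jump_area = (\sum_(i <oo) \sum_(j <oo | j != i) (Q i j)%:E)%E.
  by rewrite H; exact: flux_sum_le.
apply: etrans _ E.
rewrite -[LHS](_ : \int[mu2]_y (\1_jump_area y)%:E = _)%E; last first.
  by rewrite integral_indic//; congr (lebesgue2 _); rewrite setIT.
apply: eq_integral => y _.
have [c cE cnz] := jcell y.
rewrite (nneseries_cell (fun _ _ => 1%E) cE cnz).
by rewrite (indic_jump_area cE cnz); case: (c) => [[k l]|].
Qed.

Lemma norm_cell_row_partial (V : normedModType R) (F : nat -> nat -> V) (B : R)
    i n y : (forall i j, `|F i j| <= B) ->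
  `|\sum_(0 <= j < n | j != i) (\1_(A i j) y : R) *: F i j|
    <= B * \1_jump_area y.
Proof.
move=> FB; have B0 : 0 <= B by exact: le_trans (FB 0 0).
have [c cE cnz] := jcell y.
case: c cE cnz => [[k l]|] cE cnz; last first.
  rewrite big1 ?normr0; first by rewrite mulr_ge0.
  by move=> j ji; rewrite cE// scale0r.
rewrite (indic_jump_area cE cnz) mulr1.
have H j : j != i -> j != l -> (\1_(A i j) y : R) *: F i j = 0.
  move=> ji jl; rewrite cE// (_ : _ == _ = false) ?scale0r//.
  by apply/eqP => -[_ lj]; rewrite lj eqxx in jl.
have [ln|nl] := ltnP l n; last first.
  rewrite big_nat_cond big1 ?normr0// => j /andP[jn ji]; apply: H => //.
  by rewrite ltn_eqF// (leq_trans jn).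
rewrite (sum_single H ln); case: ifPn => li; last by rewrite normr0.
by rewrite normrZ ger0_norm// (le_trans _ (FB i l))// ler_piMl.
Qed.

Lemma norm_cell_sum_partial (V : normedModType R) (F : nat -> nat -> V) (B : R)
    n y : (forall i j, `|F i j| <= B) ->
  `|\sum_(0 <= i < n) cell_row Gamma q F i y| <= B * \1_jump_area y.
Proof.
move=> FB; have B0 : 0 <= B by exact: le_trans (FB 0 0).
have [c cE cnz] := jcell y.
under eq_bigr do rewrite (cell_rowE F _ cE cnz).
rewrite (indic_jump_area cE cnz).
case: c cE cnz => [[k l]|] cE cnz; last by rewrite big1// normr0 mulr0.
rewrite mulr1; have [kn|nk] := ltnP k n; last first.
  rewrite big_nat_cond big1 ?normr0// => i /andP[/= i_n _].
  by rewrite ltn_eqF// (leq_trans i_n).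
rewrite (@sum_single _ _ xpredT k)//= ?eqxx//.
by move=> i _ /negPf ->.
Qed.

Lemma norm_cell_row (V : normedModType R) (F : nat -> nat -> V) (B : R)
    i y : (forall i j, `|F i j| <= B) ->
  `|cell_row Gamma q F i y| <= B * \1_jump_area y.
Proof.
move=> FB; have [c cE cnz] := jcell y.
have B0 : 0 <= B by exact: le_trans (FB 0 0).
rewrite (cell_rowE F _ cE cnz) (indic_jump_area cE cnz).
case: (c) => [[k l]|]; last by rewrite normr0 mulr0.
by rewrite mulr1; case: ifPn => _; rewrite ?normr0.
Qed.

Lemma norm_cell_sum (V : normedModType R) (F : nat -> nat -> V) (B : R)
    y : (forall i j, `|F i j| <= B) ->
  `|cell_sum Gamma q F y| <= B * \1_jump_area y.
Proof.
move=> FB; have [c cE cnz] := jcell y.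
rewrite (cell_sumE F cE cnz) (indic_jump_area cE cnz).
by case: (c) => [[k l]|]; rewrite ?normr0 ?mulr0// mulr1.
Qed.

Lemma coord_measurable_cell_row (F : nat -> nat -> l2 R) i :
  @coord_measurable _ T2 R setT (cell_row Gamma q F i).
Proof.
apply: (coord_measurable_cvg (F := fun n (y : T2) =>
    \sum_(0 <= j < n | j != i) (\1_(A i j) y : R) *: F i j)); last first.
  by move=> y _; exact: cvg_cell_row.
move=> n; apply: coord_measurable_sum => j _; apply: coord_measurableZ.
  exact: measurable_indic.
exact: coord_measurable_cst.
Qed.

Lemma coord_measurable_cell_sum (F : nat -> nat -> l2 R) :
  @coord_measurable _ T2 R setT (cell_sum Gamma q F).
Proof.
apply: (coord_measurable_cvg (F := fun n (y : T2) =>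
    \sum_(0 <= i < n) cell_row Gamma q F i y)); last first.
  by move=> y _; exact: cvg_cell_sum.
by move=> n; apply: coord_measurable_sum => i _;
  exact: coord_measurable_cell_row.
Qed.

Section square_integrable.
Variable h : R * R -> R.
Hypothesis mh : measurable_fun (setT : set T2) h.
Hypothesis h2 : (\int[mu2]_y (h y ^+ 2)%:E < +oo)%E.

Let mh2 : measurable_fun (setT : set T2) (fun y : T2 => (h y ^+ 2)%:E).
Proof. by apply/measurable_EFinP; exact: measurable_funX. Qed.

Lemma jump_bound_integrable (B : R) :
  mu2.-integrable setT (EFin \o (fun y : T2 =>
    B * (h y ^+ 2 + \1_jump_area y))).
Proof.
apply: (integrableZl measurableT B (f := EFin \o
  (fun y : T2 => h y ^+ 2 + \1_jump_area y))).
apply: (integrableD measurableT (f := EFin \o (fun y : T2 => h y ^+ 2))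
  (g := EFin \o \1_jump_area)).
  apply/integrableP; split => //.
  by under eq_integral do rewrite /= ger0_norm ?sqr_ge0//.
rewrite (_ : _ \o _ = EFin \o (fun y : T2 => \1_jump_area y * 1)); last first.
  by apply/funext => y /=; rewrite mulr1.
apply: integrable_indicZ => //; first exact: measurable_jump_area.
by rewrite setTI; apply: le_lt_trans measure_jump_area_le _; rewrite ltry.
Qed.

Lemma jump_bound_ge (B : R) (V : normedModType R) (x : V) y :
  0 <= B -> `|x| <= B * \1_jump_area y ->
  `|h y *: x| <= B * (h y ^+ 2 + \1_jump_area y).
Proof.
move=> B0 xB; rewrite normrZ; apply: (le_trans (ler_wpM2l (normr_ge0 _) xB)).
rewrite mulrCA ler_wpM2l//.
rewrite indicE; case: (_ \in _); last by rewrite mulr0 addr0 sqr_ge0.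
(* On the area of the jumps, |h| <= h^2 + 1. *)
rewrite mulr1 (_ : true%:R = 1)// -real_normK ?num_real//.
have := sqr_ge0 (`|h y| - 1); have := normr_ge0 (h y); nra.
Qed.

(** The mass that h gives to a transition. *)
Definition cell_integral i j : R := \int[mu2]_y (h y * \1_(A i j) y).

Lemma cell_integrable i j : j != i ->
  mu2.-integrable setT (EFin \o (fun y : T2 => h y * \1_(A i j) y)).
Proof.
move=> ji; apply: (le_integrable measurableT _ _ (jump_bound_integrable 1)).
  by apply/measurable_EFinP; apply: measurable_funM => //;
    exact: measurable_indic.
move=> y _ /=; rewrite lee_fin [leRHS]ger0_norm; last first.
  by rewrite mul1r addr_ge0 ?sqr_ge0.
apply: (@jump_bound_ge 1 R^o (\1_(A i j) y) y) => //.
rewrite ger0_norm// mul1r !indicE ler_nat.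
case: (boolP (y \in A i j)) => // /set_mem Ay.
by rewrite mem_set//; exists i => //; exists j.
Qed.

Let jv i j : l2 R := unit_vector R j - unit_vector R i.

Let jv2 i j : `|jv i j| <= 2. Proof. exact: norm_unit_vectorB. Qed.

Lemma jump_norm_integrable :
  norm_integrable mu2 setT (fun y : T2 => h y *: jump Gamma q y).
Proof.
apply: (le_norm_integrable measurableT _ (jump_bound_integrable 2)).
  by apply: coord_measurableZ => //; exact: (coord_measurable_cell_sum jv).
by move=> y _; apply: jump_bound_ge => //; exact: (norm_cell_sum y jv2).
Qed.

(** Integrating the jumps against h amounts to summing the jumps weighted by
    the masses of their transitions. *)
Lemma series_weak_integral v :
  weak_integral mu2 setT (fun y : T2 => h y *: jump Gamma q y) v ->
  \sum_(i <oo) \sum_(j <oo | j != i)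
    cell_integral i j *: (unit_vector R j - unit_vector R i) = v.
Proof.
move=> hv.
have mrow i : @coord_measurable _ T2 R setT (fun y : T2 =>
  h y *: cell_row Gamma q jv i y).
  by apply: coord_measurableZ => //; exact: coord_measurable_cell_row.
have rowb i y : `|h y *: cell_row Gamma q jv i y| <=
    2 * (h y ^+ 2 + \1_jump_area y).
  by apply: jump_bound_ge => //; exact: norm_cell_row.
have rowi i : norm_integrable mu2 setT (fun y : T2 =>
  h y *: cell_row Gamma q jv i y).
  exact: (le_norm_integrable measurableT (mrow i) (jump_bound_integrable 2)).
have /choice[X hX] i := weak_integral_exists measurableT (rowi i).
have rowE i : \sum_(j <oo | j != i) cell_integral i j *: jv i j = X i.
  apply: cvg_lim; first exact: norm_hausdorff.
  pose F n (y : T2) := h y *: \sum_(0 <= j < n | j != i) (\1_(A i j) y : R) *: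
    jv i j.
  have mF n : @coord_measurable _ T2 R setT (F n).
    apply: coord_measurableZ => //.
    apply: coord_measurable_sum => j _; apply: coord_measurableZ.
      exact: measurable_indic.
    exact: coord_measurable_cst.
  have cF (y : T2) : setT y ->
    F n y @[n --> \oo] --> h y *: cell_row Gamma q jv i y.
    by move=> _; apply: cvgZ; [exact: cvg_cst|exact: cvg_cell_row].
  have Fb n (y : T2) : setT y -> `|F n y| <= 2 * (h y ^+ 2 + \1_jump_area y).
    by move=> _; apply: jump_bound_ge => //; exact: norm_cell_row_partial.
  have FV n : weak_integral mu2 setT (F n)
      (\sum_(0 <= j < n | j != i) cell_integral i j *: jv i j).
    rewrite /F; under eq_fun do rewrite scaler_sumr.
    apply: weak_integral_sum => // j ji; under eq_fun do rewrite scalerA.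
      by apply: norm_integrable_scale => //; exact: cell_integrable.
    by apply: weak_integral_scale => //; exact: cell_integrable.
  exact: (weak_integral_dominated_cvg measurableT mF cF
    (jump_bound_integrable 2) Fb (fun y _ => rowb i y) FV (hX i)).
rewrite (_ : (fun n => _) = (fun n => \sum_(0 <= i < n) X i)); last first.
  by apply/funext => n; apply: eq_bigr => i _; exact: rowE.
apply: cvg_lim; first exact: norm_hausdorff.
pose F n (y : T2) := h y *: \sum_(0 <= i < n) cell_row Gamma q jv i y.
have mF n : @coord_measurable _ T2 R setT (F n).
  apply: coord_measurableZ => //.
  by apply: coord_measurable_sum => i _; exact: coord_measurable_cell_row.
have cF (y : T2) : setT y -> F n y @[n --> \oo] --> h y *: jump Gamma q y.
  move=> _; apply: cvgZ; first exact: cvg_cst.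
  rewrite -[jump Gamma q y]/(cell_sum Gamma q jv y).
  exact: cvg_cell_sum.
have Fb n (y : T2) : setT y -> `|F n y| <= 2 * (h y ^+ 2 + \1_jump_area y).
  by move=> _; apply: jump_bound_ge => //; exact: norm_cell_sum_partial.
have fb (y : T2) : setT y ->
    `|h y *: jump Gamma q y| <= 2 * (h y ^+ 2 + \1_jump_area y).
  by move=> _; apply: jump_bound_ge => //; exact: (norm_cell_sum y jv2).
have FV n : weak_integral mu2 setT (F n) (\sum_(0 <= i < n) X i).
  rewrite /F; under eq_fun do rewrite scaler_sumr.
  by apply: (weak_integral_sum measurableT) => i _; [exact: rowi|exact: hX].
exact: (weak_integral_dominated_cvg measurableT mF cF
  (jump_bound_integrable 2) Fb fb FV hv).
Qed.

End square_integrable.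

End jump_integrals.

(** * Costs of the controls at a fixed time *)

Section control_costs.
Context (R : realType) (Gamma : l2 R -> nat -> nat -> R).
Hypothesis Gamma_rate : forall q, simplex q -> rate_matrix (Gamma q).
Hypothesis rate_sup_fin : (rate_sup Gamma < +oo)%E.
Variables (q : l2 R) (Sq : simplex q).
Local Notation A := (jump_set Gamma q).
Local Notation Q i j := (q i * Gamma q i j).
Local Notation mu2 := (@lebesgue2 R).
Local Notation T2 := (measurableTypeR R * measurableTypeR R)%type.

Let jcell y := jump_cell Gamma_rate rate_sup_fin Sq y.

Let mA i j : measurable (A i j : set T2).
Proof. exact: measurable_jump_set. Qed.

Let measure_A i j : j != i -> mu2 (setT `&` A i j) = (Q i j)%:E.
Proof.
move=> ji; apply: etrans (measure_jump_set Gamma_rate rate_sup_fin Sq ji).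
by congr (lebesgue2 _); rewrite setTI.
Qed.

Let measure_A_fin i j : j != i -> (mu2 (setT `&` A i j) < +oo)%E.
Proof. by move=> ji; rewrite measure_A// ltry. Qed.

Lemma Rintegral_jump_set i j c : j != i ->
  \int[mu2]_y (\1_(A i j) y * c) = Q i j * c.
Proof.
move=> ji.
apply: etrans (Rintegral_indicZ c measurableT (mA i j) (measure_A_fin ji)) _.
by congr (_ * _); exact: (congr1 fine (measure_A ji)).
Qed.

Let Q_ge0 i j : j != i -> 0 <= Q i j.
Proof. exact: flux_ge0. Qed.

Lemma integral_cells (F : nat -> nat -> T2 -> R) :
  (forall i j, measurable_fun setT (F i j)) -> (forall i j y, 0 <= F i j y) ->
  (\int[mu2]_y (\sum_(i <oo) \sum_(j <oo | j != i)
      ((\1_(A i j) y)%:E * (F i j y)%:E)) =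
   \sum_(i <oo) \sum_(j <oo | j != i)
      \int[mu2]_y (\1_(A i j) y * F i j y)%:E)%E.
Proof.
move=> mF F0; apply: (integral_nneseries2 mu2 (P := fun i j => j != i)
  (F := fun i j (y : T2) => ((\1_(A i j) y)%:E * (F i j y)%:E)%E)).
- by move=> i j; apply: emeasurable_funM; apply/measurable_EFinP.
- by move=> i j y _; rewrite -EFinM lee_fin mulr_ge0.
Qed.

(** By the Cauchy-Schwarz inequality on the set of the transition. *)
Lemma sqr_cell_integral_le (h : T2 -> R) i j : j != i ->
  measurable_fun setT h -> (\int[mu2]_y (h y ^+ 2)%:E < +oo)%E ->
  (((cell_integral Gamma q h i j / Num.sqrt (Q i j)) ^+ 2)%:E <=
   \int[mu2]_y (\1_(A i j) y * h y ^+ 2)%:E)%E.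
Proof.
move=> ji mh h2; set c := cell_integral _ _ _ _ _.
have [Q0|Qn0] := eqVneq (Q i j) 0.
  rewrite Q0 sqrtr0 invr0 mulr0 expr0n; apply: integral_ge0 => y _.
  by rewrite lee_fin mulr_ge0// sqr_ge0.
(* The mean of h over the set; the claim is that (h - t)^2 has a nonnegative
   integral there. *)
pose t := c / Q i j.
have mh2 : measurable_fun (setT : set T2) (fun y => h y ^+ 2).
  exact: measurable_funX.
have i1 : mu2.-integrable setT (EFin \o (fun y : T2 =>
  \1_(A i j) y * h y ^+ 2)).
  apply/integrableP; split.
    by apply/measurable_EFinP; apply: measurable_funM => //;
      exact: measurable_indic.
  apply: le_lt_trans h2; apply: ge0_le_integral => //.
  - apply: measurableT_comp => //; apply/measurable_EFinP.
    by apply: measurable_funM => //; exact: measurable_indic.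
  - exact/measurable_EFinP.
  - move=> y _ /=; rewrite lee_fin ger0_norm;
      last by rewrite mulr_ge0// sqr_ge0.
    by rewrite ler_piMl// sqr_ge0.
have i2 : mu2.-integrable setT (EFin \o (fun y : T2 => h y * \1_(A i j) y)).
  exact: (cell_integrable Gamma_rate rate_sup_fin Sq mh h2 ji).
have i3 := integrable_indicZ (t ^+ 2) measurableT (mA i j) (measure_A_fin ji).
have i4 : mu2.-integrable setT
    (EFin \o (fun y : T2 => 2 * t * (h y * \1_(A i j) y))).
  exact: (integrableZl measurableT (2 * t) i2).
have E : \int[mu2]_y (2 * t * (h y * \1_(A i j) y) - \1_(A i j) y * t ^+ 2) =
    (c / Num.sqrt (Q i j)) ^+ 2.
  rewrite RintegralB// RintegralZl// Rintegral_jump_set//.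
  rewrite -/(cell_integral Gamma q h i j) -/c [RHS]exprMn exprVn sqr_sqrtr
    ?Q_ge0//.
  by rewrite /t; move: (q i * Gamma q i j) Qn0 => r r0; field.
rewrite -E -[leRHS]fineK; last exact: (integrable_fin_num measurableT i1).
rewrite lee_fin; apply: (le_Rintegral measurableT _ i1).
  exact: (integrableB measurableT i4 i3).
move=> y _; rewrite indicE; case: (_ \in _) => /=.
  rewrite !mulr1 !mul1r -subr_ge0.
  by rewrite (_ : _ - _ = (h y - t) ^+ 2) ?sqr_ge0//; ring.
by rewrite !mulr0 !mul0r subrr.
Qed.

Lemma cell_cost_le (h : T2 -> R) : measurable_fun setT h ->
  (\sum_(i <oo) \sum_(j <oo | j != i)
     ((cell_integral Gamma q h i j / Num.sqrt (Q i j)) ^+ 2)%:E <=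
   \int[mu2]_y (h y ^+ 2)%:E)%E.
Proof.
move=> mh.
have [->|] := eqVneq (\int[mu2]_y (h y ^+ 2)%:E)%E +oo%E; first by rewrite leey.
rewrite -ltey => h2.
have mh2 : measurable_fun (setT : set T2) (fun y => h y ^+ 2).
  exact: measurable_funX.
apply: (@le_trans _ _ (\sum_(i <oo) \sum_(j <oo | j != i)
      \int[mu2]_y (\1_(A i j) y * h y ^+ 2)%:E)%E).
  apply: lee_nneseries => i _.
    by move=> _; apply: nneseries_ge0 => j _ _; rewrite lee_fin sqr_ge0.
  apply: lee_nneseries => j.
    by move=> _ _; rewrite lee_fin sqr_ge0.
  by move=> ji; exact: sqr_cell_integral_le.
have -> := esym (@integral_cells (fun _ _ y => h y ^+ 2) (fun _ _ => mh2)
  (fun _ _ y => sqr_ge0 (h y))).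
apply: le_lower_integral.
- move=> y _; apply: nneseries_ge0 => i _ _; apply: nneseries_ge0 => j _ _.
  by rewrite -EFinM lee_fin mulr_ge0// sqr_ge0.
- by move=> y _; rewrite lee_fin sqr_ge0.
move=> y _; split => //; have [c cE cnz] := jcell y.
rewrite (nneseries_cell (fun _ _ => (h y ^+ 2)%:E) cE cnz).
by case: (c) => [[k l]|]; rewrite lee_fin ?sqr_ge0.
Qed.

Section spread.
Variable u : nat -> nat -> R.

(** The control of the plane that spreads the control of each transition evenly
    over the set of the transition. Where the flux is 0 the set is empty. *)
Definition spread_control (y : R * R) : R :=
  cell_sum Gamma q (V := R^o) (fun i j => u i j / Num.sqrt (Q i j)) y.

Lemma spread_control_cell_integral i j : j != i ->
  cell_integral Gamma q spread_control i j = Num.sqrt (Q i j) * u i j.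
Proof.
move=> ji; rewrite /cell_integral.
transitivity (\int[mu2]_y (\1_(A i j) y * (u i j / Num.sqrt (Q i j)))).
  apply: eq_Rintegral => y _; have [c cE cnz] := jcell y.
  rewrite cE//; case: eqP => [cij|_]; last by rewrite mulr0 mul0r.
  rewrite cij in cE cnz.
  by rewrite /spread_control (cell_sumE (V := R^o) _ cE cnz) mulr1 mul1r.
rewrite Rintegral_jump_set//.
have [->|Qn0] := eqVneq (Q i j) 0; first by rewrite sqrtr0 !mul0r.
rewrite -{1}(sqr_sqrtr (Q_ge0 ji)); field.
by rewrite sqrtr_eq0 -ltNge lt_neqAle eq_sym Qn0 Q_ge0.
Qed.

Lemma spread_control_cost :
  (\int[mu2]_y (spread_control y ^+ 2)%:E <=
   \sum_(i <oo) \sum_(j <oo | j != i) (u i j ^+ 2)%:E)%E.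
Proof.
pose d i j := (u i j / Num.sqrt (Q i j)) ^+ 2.
have E : (\int[mu2]_y (spread_control y ^+ 2)%:E =
    \int[mu2]_y (\sum_(i <oo) \sum_(j <oo | j != i)
      ((\1_(A i j) y)%:E * (d i j)%:E)))%E.
  apply: eq_integral => y _; have [c cE cnz] := jcell y.
  rewrite /spread_control (cell_sumE (V := R^o) _ cE cnz).
  rewrite (nneseries_cell (fun i j => (d i j)%:E) cE cnz).
  by case: (c) => [[k l]|] //; congr EFin; exact: (expr0n R 2).
rewrite E (@integral_cells (fun i j _ => d i j))//; last first.
  by move=> *; exact: sqr_ge0.
apply: lee_nneseries => i _.
  move=> _; apply: nneseries_ge0 => j _ _; apply: integral_ge0 => y _.
  by rewrite lee_fin mulr_ge0// sqr_ge0.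
apply: lee_nneseries => j.
  move=> _ _; apply: integral_ge0 => y _.
  by rewrite lee_fin mulr_ge0// sqr_ge0.
move=> ji.
have i1 := integrable_indicZ (d i j) measurableT (mA i j) (measure_A_fin ji).
rewrite -[leLHS]fineK; last exact: (integrable_fin_num measurableT i1).
rewrite lee_fin -/(Rintegral _ _ _) Rintegral_jump_set// /d.
have [->|Qn0] := eqVneq (Q i j) 0; first by rewrite mul0r sqr_ge0.
by rewrite exprMn exprVn sqr_sqrtr ?Q_ge0// mulrC mulfVK.
Qed.

End spread.

End control_costs.

(** * Measurability in time and space *)

Section flow.
Context (R : realType) (Gamma : l2 R -> nat -> nat -> R) (LG T : R).
Variable p : R -> l2 R.
Hypothesis Gamma_rate : forall q, simplex q -> rate_matrix (Gamma q).
Hypothesis rate_sup_fin : (rate_sup Gamma < +oo)%E.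
Hypothesis Gamma_lip : forall q q' : l2 R, simplex q -> simplex q' ->
  (ereal_sup (range (fun i =>
     \sum_(j <oo | j != i) (`|Gamma q' i j - Gamma q i j|)%:E))
   <= (LG * `|q' - q|)%:E)%E.
Hypothesis T_gt0 : 0 < T.
Hypothesis p_simplex : forall t, 0 <= t <= T -> simplex (p t).
Hypothesis p_cont : {within `[0, T], continuous p}.

Local Notation T1 := (measurableTypeR R).
Local Notation T2 := (T1 * T1)%type.
Local Notation T3 := (T1 * T2)%type.
Local Notation mu := (@lebesgue_measure R).
Local Notation mu2 := (@lebesgue2 R).
Local Notation gamma := (fine (rate_sup Gamma)).
Local Notation timeT := (`[0, T]%classic : set T1).

Let timeP s : timeT s -> simplex (p s).
Proof. by rewrite /= in_itv => /p_simplex. Qed.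

(** The rate at which mass flows from i to j at time s. *)
Definition flux (s : R) i j := p s i * Gamma (p s) i j.

(** Functions of the time that are Lipschitz in p are continuous, hence
    measurable. *)
Lemma measurable_lipschitz_along (f : R -> R) (K : R) : 0 <= K ->
  (forall s t, timeT s -> timeT t -> `|f s - f t| <= K * `|p s - p t|) ->
  measurable_fun timeT (f : T1 -> R).
Proof.
move=> K0 Hf.
have mT : measurable (`[0, T]%classic : set R) by exact: measurable_itv.
suff cf : {within `[0, T], continuous f}.
  exact: (subspace_continuous_measurable_fun mT cf).
apply/subspace_continuousP => s sT; apply/cvgrPdist_lt => e e0.
have K1 : 0 < K + 1 by rewrite ltr_wpDl.
have eK : 0 < e / (K + 1) by rewrite divr_gt0.
move/subspace_continuousP : p_cont => /(_ s sT) /cvgrPdist_lt /(_ _ eK) Hp.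
near=> t.
have tT : timeT t by near: t; exact: withinT.
apply: le_lt_trans (Hf _ _ sT tT) _.
have : `|p s - p t| < e / (K + 1) by near: t; exact: Hp.
rewrite ltr_pdivlMr//; apply: le_lt_trans.
by rewrite mulrC ler_wpM2l// lerDl.
Unshelve. all: by end_near. Qed.

Lemma Gamma_offdiag_lip q q' i j : simplex q -> simplex q' -> j != i ->
  `|Gamma q' i j - Gamma q i j| <= LG * `|q' - q|.
Proof.
move=> Sq Sq' ji; rewrite -lee_fin; apply: le_trans (Gamma_lip Sq Sq').
apply: (@le_trans _ _ (\sum_(j <oo | j != i)
    (`|Gamma q' i j - Gamma q i j|)%:E)%E).
  exact: (@nneseries_term_le _ (fun j => (`|Gamma q' i j - Gamma q i j|)%:E)
    (fun j => j != i)).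
by apply: ereal_sup_ubound; exists i.
Qed.

Lemma measurable_flux i j : j != i ->
  measurable_fun timeT ((fun s => flux s i j) : T1 -> R).
Proof.
move=> ji; apply: measurable_funM.
  apply: (@measurable_lipschitz_along _ 1) => // s t _ _.
  by rewrite mul1r -l2_coordB l2_coord_le.
apply: (@measurable_lipschitz_along _ `|LG|) => // s t sT tT.
apply: le_trans (Gamma_offdiag_lip (timeP tT) (timeP sT) ji) _.
by rewrite ler_wpM2r// ler_norm.
Qed.

(** The times of [0, T] and points of the plane at which the transition from i
    to j occurs. *)
Definition jump_graph i j : set T3 :=
  [set z | timeT z.1 /\ jump_set Gamma (p z.1) i j z.2].

(** All the points of the plane at the times of [0, T]. *)
Definition strip : set T3 := timeT `*` setT.

Lemma measurable_strip : measurable strip.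
Proof. by apply: measurableX => //; exact: measurable_itv. Qed.

Let mid : measurable_fun (setT : set T1) (fun x : T1 => x : R).
Proof. by move=> _ Y mY; rewrite setTI. Qed.

Lemma measurable_jump_graph i j : j != i -> measurable (jump_graph i j).
Proof.
move=> ji.
have mT : measurable timeT by exact: measurable_itv.
have m1 : measurable_fun (setT : set T3) (fun z : T3 => z.2.1 : R).
  apply: (measurableT_comp mid).
  by apply: (measurableT_comp measurable_fst); exact: measurable_snd.
have m2 : measurable_fun (setT : set T3) (fun z : T3 => z.2.2 : R).
  apply: (measurableT_comp mid).
  by apply: (measurableT_comp measurable_snd); exact: measurable_snd.
have mf : measurable_fun strip (fun z : T3 => z.2.2 - flux z.1 i j : R).
  apply: measurable_funB; first exact: measurable_funTS.
  apply: (measurable_comp mT _ (measurable_flux ji)).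
    by move=> _ [z [zT _] <-].
  by apply: measurable_funTS; exact: measurable_fst.
rewrite (_ : jump_graph i j = (strip `&` (fun z : T3 =>
  z.2.2 - flux z.1 i j) @^-1`
    `]-oo, (j%:R * gamma)]) `&`
   ((fun z : T3 => z.2.1 : R) @^-1` `]i%:R, i.+1%:R] `&`
    (fun z : T3 => z.2.2 : R) @^-1` `](j%:R * gamma), +oo[)).
  apply: measurableI; first by apply: mf => //; exact: measurable_strip.
  apply: measurableI.
    by rewrite -[X in measurable X]setTI; apply: m1.
  by rewrite -[X in measurable X]setTI; apply: m2.
apply/seteqP; split => [[s y]/= [sT]|[s y]/=].
  rewrite (jump_setE rate_sup_fin (timeP sT)) => -[/= y1 y2].
  rewrite !in_itv/= in y1 y2 *; case/andP: y2 => y2 y2'.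
  by rewrite y1 andbT y2 lerBlDr -/(flux s i j).
rewrite !in_itv/= andbT lerBlDr => -[[[sT _] y2'] [y1 y2]].
split => //; rewrite (jump_setE rate_sup_fin (timeP sT)).
by split; rewrite /= in_itv/= ?y1// y2.
Qed.

Lemma indic_jump_graph i j s y : timeT s ->
  \1_(jump_graph i j) (s, y) = \1_(jump_set Gamma (p s) i j) y :> R.
Proof.
move=> sT; rewrite !indicE; congr (_%:R); congr nat_of_bool.
by apply/idP/idP => [/set_mem[_ H]|/set_mem H]; apply/mem_set.
Qed.

(** As a limit of limits of finite sums of indicators of jump graphs. *)
Lemma coord_measurable_jump :
  coord_measurable strip (fun z : T3 => jump Gamma (p z.1) z.2).
Proof.
pose jv i j : l2 R := unit_vector R j - unit_vector R i.
have mrow i : coord_measurable strip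
    (fun z : T3 => cell_row Gamma (p z.1) jv i z.2).
  apply: (coord_measurable_cvg (F := fun n (z : T3) =>
      \sum_(0 <= j < n | j != i) (\1_(jump_set Gamma (p z.1) i j) z.2 : R)
        *: jv i j)); last first.
    move=> z [zT _]; exact: (cvg_cell_row Gamma_rate rate_sup_fin (timeP zT)).
  move=> n; apply: coord_measurable_sum => j ji; apply: coord_measurableZ.
    apply: (@eq_measurable_fun _ _ _ _ _ (\1_(jump_graph i j) : T3 -> R)).
      by move=> [s y] /set_mem[/= sT _]; exact: indic_jump_graph.
    by apply: measurable_indic; exact: measurable_jump_graph.
  exact: coord_measurable_cst.
apply: (coord_measurable_cvg (F := fun n (z : T3) =>
    \sum_(0 <= i < n) cell_row Gamma (p z.1) jv i z.2)); last first.
  move=> z [zT _]; exact: (cvg_cell_sum Gamma_rate rate_sup_fin (timeP zT)).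
by move=> n; apply: coord_measurable_sum => i _.
Qed.

Lemma measurable_spread_control (u : nat -> nat -> R -> R) :
  (forall i j, measurable_fun timeT (u i j : T1 -> R)) ->
  measurable_fun strip
    (fun z : T3 => spread_control Gamma (p z.1) (fun i j => u i j z.1) z.2).
Proof.
move=> mu_.
have mT : measurable timeT by exact: measurable_itv.
pose d (z : T3) i j : R^o := u i j z.1 / Num.sqrt (flux z.1 i j).
have mfst : measurable_fun strip (fst : T3 -> T1).
  by apply: measurable_funTS; exact: measurable_fst.
have fstT : fst @` strip `<=` timeT by move=> _ [z [zT _] <-].
have md i j : j != i -> measurable_fun strip (fun z : T3 => d z i j : R).
  move=> ji; apply: measurable_funM.
    exact: (measurable_comp mT fstT (mu_ i j) mfst).
  (* The inverse of the square root as a power; both are 0 at 0. *)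
  apply: (@eq_measurable_fun _ _ _ _ _
      (fun z : T3 => flux z.1 i j `^ (- 2^-1) : R)).
    move=> z /set_mem[zT _]; rewrite powRN powR12_sqrt//.
    exact: (flux_ge0 Gamma_rate (timeP zT)).
  apply: (measurableT_comp (measurable_powR (- 2^-1))).
  exact: (measurable_comp mT fstT (measurable_flux ji) mfst).
have mrow i : measurable_fun strip
    (fun z : T3 => cell_row Gamma (p z.1) (d z) i z.2 : R).
  apply: (@measurable_fun_cvg _ _ _ _ (fun n (z : T3) =>
      \sum_(0 <= j < n | j != i) (\1_(jump_set Gamma (p z.1) i j) z.2 : R)
        *: d z i j)); last first.
    move=> z [zT _]; exact: (cvg_cell_row Gamma_rate rate_sup_fin (timeP zT)).
  move=> n; under eq_fun do rewrite big_mkcond/=.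
  apply: measurable_sum => j; case: (boolP (j != i)) => ji; last first.
    exact: measurable_cst.
  apply: measurable_funM; last exact: md.
  apply: (@eq_measurable_fun _ _ _ _ _ (\1_(jump_graph i j) : T3 -> R)).
    by move=> [s y] /set_mem[/= sT _]; exact: indic_jump_graph.
  by apply: measurable_indic; exact: measurable_jump_graph.
apply: (@measurable_fun_cvg _ _ _ _ (fun n (z : T3) =>
    \sum_(0 <= i < n) cell_row Gamma (p z.1) (d z) i z.2)); last first.
  move=> z [zT _]; exact: (cvg_cell_sum Gamma_rate rate_sup_fin (timeP zT)).
by move=> n; apply: measurable_sum.
Qed.

End flow.

(** * Two controls driving the same equation *)

Lemma cell_integral_null (R : realType) (Gamma : l2 R -> nat -> nat -> R) :
  (forall q, simplex q -> rate_matrix (Gamma q)) -> (rate_sup Gamma < +oo)%E ->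
  forall (q : l2 R), simplex q ->
  forall (h : measurableTypeR R * measurableTypeR R -> R) i j,
  j != i -> measurable_fun setT h -> q i * Gamma q i j = 0 ->
  cell_integral Gamma q h i j = 0.
Proof.
move=> Gr rs q Sq h i j ji mh Q0.
transitivity (\int[@lebesgue2 R]_(y in jump_set Gamma q i j) h y).
  rewrite [RHS]Rintegral_mkcond; apply: eq_Rintegral => y _.
  rewrite patchE indicE; case: ifPn => _; first by rewrite mulr1.
  by rewrite mulr0.
rewrite /Rintegral null_set_integral//.
- exact: measurable_jump_set.
- by apply/measurable_EFinP; exact: measurable_funTS.
- by apply: etrans (measure_jump_set Gr rs Sq ji) _; rewrite Q0.
Qed.

Section transport.
Context (R : realType) (Gamma : l2 R -> nat -> nat -> R) (LG T : R).
Variable p : R -> l2 R.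
Hypothesis Gamma_rate : forall q, simplex q -> rate_matrix (Gamma q).
Hypothesis rate_sup_fin : (rate_sup Gamma < +oo)%E.
Hypothesis Gamma_lip : forall q q' : l2 R, simplex q -> simplex q' ->
  (ereal_sup (range (fun i =>
     \sum_(j <oo | j != i) (`|Gamma q' i j - Gamma q i j|)%:E))
   <= (LG * `|q' - q|)%:E)%E.
Hypothesis T_gt0 : 0 < T.
Hypothesis p_simplex : forall t, 0 <= t <= T -> simplex (p t).
Hypothesis p_cont : {within `[0, T], continuous p}.

Local Notation T1 := (measurableTypeR R).
Local Notation T2 := (T1 * T1)%type.
Local Notation T3 := (T1 * T2)%type.
Local Notation mu := (@lebesgue_measure R).
Local Notation mu2 := (@lebesgue2 R).
Local Notation lam := (@lambda R).
Local Notation gamma := (fine (rate_sup Gamma)).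
Local Notation timeT := (`[0, T]%classic : set T1).
Local Notation domT := (timeT `*` (@XX R : set T2)).
Local Notation flux := (flux Gamma p).

Let timeP s : timeT s -> simplex (p s).
Proof. by rewrite /= in_itv => /p_simplex. Qed.

Let mtime : measurable timeT. Proof. exact: measurable_itv. Qed.

Lemma measurable_XX : measurable (@XX R : set T2).
Proof. by apply: measurableX; exact: measurable_itv. Qed.

Let mdom : measurable domT.
Proof. by apply: measurableX => //; exact: measurable_XX. Qed.

Variable psi : T3 -> R.
Hypothesis psiL2 : L2_fun lam domT psi.

(** The control, extended by 0 outside the times of [0, T] and the points of the
    plane on which it acts. *)
Definition extended_control : T3 -> R := psi \_ domT.
Local Notation psit := extended_control.

Lemma measurable_extended_control : measurable_fun setT psit.
Proof.
apply/measurable_restrict => //; rewrite setTI; exact: psiL2.1.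
Qed.
Let mpsit := measurable_extended_control.

Let mpsit2 : measurable_fun setT (fun z : T3 => (psit z ^+ 2)%:E).
Proof. by apply/measurable_EFinP; exact: measurable_funX. Qed.

Lemma measurable_section s : measurable_fun setT (fun y : T2 => psit (s, y)).
Proof. exact: measurable_fun_pair2 mpsit. Qed.

(** The cost of the control at a time. *)
Definition cost_at (s : T1) : \bar R := (\int[mu2]_y (psit (s, y) ^+ 2)%:E)%E.

Lemma measurable_cost_at : measurable_fun setT cost_at.
Proof.
apply: (measurable_fun_fubini_tonelli_F (m2 := mu2)
  (fun z : T3 => (psit z ^+ 2)%:E)) => // z.
by rewrite lee_fin sqr_ge0.
Qed.

Lemma cost_at_ge0 s : (0 <= cost_at s)%E.
Proof. by apply: integral_ge0 => y _; rewrite lee_fin sqr_ge0. Qed.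

Lemma integral_cost_at :
  (\int[mu]_s cost_at s = \int[lam]_(z in domT) (psi z ^+ 2)%:E)%E.
Proof.
apply: esym; rewrite integral_mkcond.
apply: etrans (fubini_tonelli1 (m1 := mu) (m2 := mu2)
  (fun z : T3 => (psit z ^+ 2)%:E) mpsit2 _); last first.
  by move=> z; rewrite lee_fin sqr_ge0.
apply: eq_integral => z _; rewrite /extended_control !patchE.
by case: ifPn => // _; rewrite expr0n.
Qed.

Lemma integral_cost_at_lty : (\int[mu]_s cost_at s < +oo)%E.
Proof. by rewrite integral_cost_at; exact: psiL2.2. Qed.

Lemma extended_control_out s y : ~ timeT s -> psit (s, y) = 0.
Proof.
by move=> sT; rewrite /extended_control patchE memNset// => -[].
Qed.

(** Functions dominated by the squared control plus the area of the jumps are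
    integrable in time and space. *)
Lemma integrable_dominated (phi : T3 -> R) (B : R) : 0 <= B ->
  measurable_fun setT phi ->
  (forall s y, timeT s ->
    `|phi (s, y)| <= B * (psit (s, y) ^+ 2 + \1_(jump_area Gamma (p s)) y)) ->
  (forall s y, ~ timeT s -> phi (s, y) = 0) ->
  lam.-integrable setT (EFin \o phi).
Proof.
move=> B0 mphi phiB phi0.
have mphiE : measurable_fun setT (EFin \o phi) by exact/measurable_EFinP.
have mc := measurable_cost_at.
have mcg : measurable_fun timeT (fun s => cost_at s + gamma%:E)%E.
  by apply: emeasurable_funD => //; exact: measurable_funTS.
have S0 : simplex (p 0) by apply: p_simplex; rewrite lexx ltW.
have g0 : 0 <= gamma := rate_sup_ge0 rate_sup_fin S0.
apply: (integrable12ltyP mu mu2 mphiE).2.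
apply: (@le_lt_trans _ _ (\int[mu]_(s in timeT)
    (B%:E * (cost_at s + gamma%:E)))%E).
  rewrite [leRHS]integral_mkcond; apply: le_lower_integral.
  - by move=> s _; exact: integral_ge0.
  - move=> s _; rewrite patchE; case: ifPn => // _.
    by rewrite mule_ge0// adde_ge0// cost_at_ge0.
  move=> s _; split => //; rewrite patchE; case: ifPn => [/set_mem sT|sT].
    have Sq := timeP sT.
    have mA := measurable_jump_area rate_sup_fin Sq.
    have m1 : measurable_fun (setT : set T2) (fun y => (psit (s, y) ^+ 2)%:E).
      by apply/measurable_EFinP; apply: measurable_funX;
        exact: measurable_section.
    have m2 : measurable_fun (setT : set T2)
        (fun y => (\1_(jump_area Gamma (p s)) y : R)%:E).
      by apply/measurable_EFinP; exact: measurable_indic.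
    apply: (@le_trans _ _ (\int[mu2]_y (B%:E * ((psit (s, y) ^+ 2)%:E +
        (\1_(jump_area Gamma (p s)) y)%:E)))%E).
      apply: le_lower_integral => // y _.
        by rewrite mule_ge0// adde_ge0 ?lee_fin ?sqr_ge0.
      by split => //; rewrite -EFinD -EFinM lee_fin; exact: phiB.
    rewrite ge0_integralZl_EFin//; last 2 first.
    - by move=> y _; rewrite adde_ge0 ?lee_fin ?sqr_ge0.
    - exact: emeasurable_funD.
    rewrite ge0_integralD//; last by move=> y _; rewrite lee_fin sqr_ge0.
    apply: lee_wpmul2l; first by rewrite lee_fin.
    apply: leeD => //; rewrite integral_indic//.
    apply: le_trans (measure_jump_area_le Gamma_rate rate_sup_fin Sq).
    by rewrite le_eqVlt; apply/orP; left; apply/eqP; congr (lebesgue2 _);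
      rewrite setIT.
  have sT' : ~ timeT s by move: sT; rewrite notin_setE.
  apply: (@le_trans _ _ (\int[mu2]_y (cst 0%E y))%E); last by rewrite integral0.
  by apply: le_lower_integral => // y _ /=; rewrite phi0// normr0.
rewrite ge0_integralZl_EFin//; last by move=> s _;
  rewrite adde_ge0// cost_at_ge0.
rewrite lte_mul_pinfty//.
have mct : measurable_fun timeT cost_at by exact: measurable_funTS.
have mgt : measurable_fun timeT (fun=> gamma%:E) by exact: measurable_cst.
rewrite (ge0_integralD mu mtime (fun s _ => cost_at_ge0 s) mct _ mgt)//.
rewrite lte_add_pinfty//.
  apply: le_lt_trans integral_cost_at_lty; apply: le_lower_integral.
  - by move=> s _; exact: cost_at_ge0.
  - by move=> s _; exact: cost_at_ge0.
  - by [].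
rewrite integral_cst//.
have muT : (mu timeT < +oo)%E.
  by rewrite lebesgue_measure_itv/= lte_fin T_gt0 -EFinB ltry.
by rewrite lte_mul_pinfty.
Qed.

(** The jumps weighted by the control. *)
Definition weighted_jump (z : T3) : l2 R := psit z *: jump Gamma (p z.1) z.2.

Let jv i j : l2 R := unit_vector R j - unit_vector R i.

Let jv2 i j : `|jv i j| <= 2. Proof. exact: norm_unit_vectorB. Qed.

Lemma coord_measurable_weighted_jump : coord_measurable setT weighted_jump.
Proof.
move=> k.
rewrite (_ : (fun z => _) =
  (fun z : T3 => psi z * jump Gamma (p z.1) z.2 k) \_ domT); last first.
  apply/funext => z; rewrite /weighted_jump /extended_control l2_coordZ !patchE.
  by case: ifPn => // _; rewrite mul0r.
apply/measurable_restrict => //; rewrite setTI.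
apply: measurable_funM; first exact: psiL2.1.
have mJ := coord_measurable_jump Gamma_rate rate_sup_fin Gamma_lip p_simplex
  p_cont k.
apply: measurable_funS mJ; first exact: measurable_strip.
by move=> z [zT _].
Qed.

Lemma weighted_jump_out s y : ~ timeT s -> weighted_jump (s, y) = 0.
Proof. by move=> sT; rewrite /weighted_jump extended_control_out// scale0r. Qed.

Lemma norm_weighted_jump_le s y : timeT s ->
  `|weighted_jump (s, y)| <=
    2 * (psit (s, y) ^+ 2 + \1_(jump_area Gamma (p s)) y).
Proof.
move=> sT; rewrite /weighted_jump/=.
apply: (jump_bound_ge (fun y => psit (s, y))) => //.
exact: (norm_cell_sum Gamma_rate rate_sup_fin (timeP sT) y jv2).
Qed.

Lemma integrable_norm_weighted_jump :
  lam.-integrable setT (EFin \o (fun z => `|weighted_jump z|)).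
Proof.
apply: (@integrable_dominated _ 2) => //.
- exact: coord_measurable_norm coord_measurable_weighted_jump.
- by move=> s y sT; rewrite normr_id; exact: norm_weighted_jump_le.
- by move=> s y sT; rewrite weighted_jump_out// normr0.
Qed.

Lemma norm_integrable_weighted_jump s : timeT s -> (cost_at s < +oo)%E ->
  norm_integrable mu2 setT (fun y : T2 => weighted_jump (s, y)).
Proof.
move=> sT cs; apply: (jump_norm_integrable Gamma_rate rate_sup_fin (timeP sT))
  => //.
exact: measurable_section.
Qed.

(** The integrals of the weighted jumps over the plane, at the times at which
    the cost is finite; 0 at the other times. *)
Lemma section_integral_exists : exists g : T1 -> l2 R,
  (forall s, timeT s -> (cost_at s < +oo)%E ->
    weak_integral mu2 setT (fun y : T2 => weighted_jump (s, y)) (g s)) /\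
  (forall s, ~ (timeT s /\ (cost_at s < +oo)%E) -> g s = 0).
Proof.
suff /choice[g gP] : forall s : T1, exists v : l2 R,
    (timeT s -> (cost_at s < +oo)%E ->
      weak_integral mu2 setT (fun y : T2 => weighted_jump (s, y)) v) /\
    (~ (timeT s /\ (cost_at s < +oo)%E) -> v = 0).
  by exists g; split => s; [exact: (gP s).1|exact: (gP s).2].
move=> s; have [[sT cs]|ns] := pselect (timeT s /\ (cost_at s < +oo)%E).
  have [v vP] := weak_integral_exists measurableT
    (norm_integrable_weighted_jump sT cs).
  by exists v; split => // ns; exfalso; apply: ns.
by exists 0; split => // sT cs; exfalso; apply: ns.
Qed.

(** A control of finite total cost has a finite cost at almost every time. *)
Lemma ae_cost_at : {ae mu, forall s : T1, (cost_at s < +oo)%E}.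
Proof.
have ci : mu.-integrable setT cost_at.
  apply/integrableP; split; first exact: measurable_cost_at.
  apply: le_lt_trans integral_cost_at_lty; apply: le_lower_integral => //.
  - by move=> s _; exact: cost_at_ge0.
  - by move=> s _; split => //; rewrite gee0_abs// cost_at_ge0.
apply: filterS (integrable_ae measurableT ci) => s /(_ I).
by rewrite ge0_fin_numE// cost_at_ge0.
Qed.

Section section_integral.
Variable g : T1 -> l2 R.
Hypothesis g_int : forall s, timeT s -> (cost_at s < +oo)%E ->
  weak_integral mu2 setT (fun y : T2 => weighted_jump (s, y)) (g s).
Hypothesis g_out : forall s, ~ (timeT s /\ (cost_at s < +oo)%E) -> g s = 0.

Lemma integrable_weighted_jump_coord k (E : set T1) : measurable E ->
  lam.-integrable setT
    (EFin \o (fun z : T3 => \1_E z.1 * weighted_jump z k)).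
Proof.
move=> mE; apply: (@integrable_dominated _ 2) => //.
- apply: measurable_funM; last exact: coord_measurable_weighted_jump.
  by apply: (measurableT_comp (measurable_indic mE)); exact: measurable_fst.
- move=> s y sT; apply: le_trans (norm_weighted_jump_le y sT).
  rewrite normrM (le_trans _ (l2_coord_le _ k))// ler_piMl// ger0_norm//.
- by move=> s y sT; rewrite weighted_jump_out// mulr0.
Qed.

Lemma section_integralE s k : timeT s -> (cost_at s < +oo)%E ->
  (\int[mu2]_y (weighted_jump (s, y) k)%:E = (g s k)%:E)%E.
Proof.
move=> sT cs; rewrite (g_int sT cs) /Rintegral fineK//.
have wi := norm_integrable_weighted_jump sT cs.
exact: (integrable_fin_num measurableT (norm_integrable_coord k measurableT
  wi)).
Qed.

Lemma coord_measurable_section_integral : coord_measurable setT g.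
Proof.
move=> k.
pose phi (z : T3) := (\1_timeT z.1 * weighted_jump z k)%:E.
pose G := timeT `&` (setT `&` [set s | cost_at s < +oo])%E.
have mG : measurable G.
  apply: measurableI => //.
  by apply: emeasurable_fun_infty_o => //; exact: measurable_cost_at.
rewrite (_ : (fun s => _) = (fine \o fubini_F mu2 phi) \_ G).
  apply/measurable_restrict => //; rewrite setTI.
  apply: measurable_funTS.
  apply: (measurableT_comp (fine_measurable measurableT)).
  apply: (measurable_fubini_F (m1 := mu)).
  exact: integrable_weighted_jump_coord.
apply/funext => s; rewrite patchE; case: ifPn => [/set_mem[sT [_ cs]]|nG].
  rewrite /= /fubini_F /phi/=.
  have -> : \1_timeT s = 1 :> R by rewrite indicE mem_set.
  under eq_integral do rewrite mul1r.
  by rewrite section_integralE.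
rewrite g_out// => -[sT cs]; move: nG; rewrite notin_setE; apply.
by split.
Qed.

Lemma norm_integrable_section_integral t : t <= T ->
  norm_integrable mu (`[0, t]%classic : set T1) g.
Proof.
move=> tT; split.
  apply: (coord_measurable_subset (E := setT)) => //.
  exact: coord_measurable_section_integral.
have /integrableP[mw wlty] := integrable_norm_weighted_jump.
have w12 := (integrable12ltyP mu mu2 mw).1 integrable_norm_weighted_jump.
apply: le_lt_trans w12; apply: le_lower_integral => //.
  by move=> s _; apply: integral_ge0.
move=> s _; split => //.
have [[sT cs]|ns] := pselect (timeT s /\ (cost_at s < +oo)%E); last first.
  by rewrite g_out// normr0; apply: integral_ge0.
have wi := norm_integrable_weighted_jump sT cs.
under eq_integral do rewrite /= normr_id.
rewrite -[leRHS]fineK; last first.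
  exact: (integrable_fin_num measurableT (norm_integrableP wi)).
by rewrite lee_fin; apply: weak_integral_norm wi (g_int sT cs).
Qed.

(** Fubini's theorem for the weighted jumps. *)
Lemma integral_weighted_jump t k : t <= T ->
  \int[lam]_(z in `[0, t] `*` @XX R) (psi z *: jump Gamma (p z.1) z.2) k =
  \int[mu]_(s in `[0, t]) g s k.
Proof.
move=> tT; pose E : set T1 := `[0, t]%classic.
have mE : measurable E by exact: measurable_itv.
have ET s : E s -> timeT s.
  by rewrite /E /= !in_itv/= => /andP[-> /le_trans ->].
pose phi (z : T3) := (\1_E z.1 * weighted_jump z k)%:E.
have iphi : lam.-integrable setT phi by exact: integrable_weighted_jump_coord.
congr fine; rewrite integral_mkcond.
transitivity (\int[lam]_z phi z)%E.
  apply: eq_integral => -[s y] _; rewrite patchE /phi /=.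
  have [sE|sE] := pselect (E s); last first.
    rewrite memNset; last by move=> [].
    by rewrite indicE memNset// mul0r.
  have [yX|yX] := pselect (XX y).
    rewrite mem_set// indicE mem_set// mul1r /weighted_jump /extended_control.
    by rewrite patchE mem_set//; split => //; exact: ET.
  rewrite memNset; last by move=> [].
  by rewrite /weighted_jump /extended_control patchE memNset ?scale0r ?mulr0//
    => -[].
apply: etrans (esym (integral12_prod_meas1 (m1 := mu) (m2 := mu2) iphi)) _.
rewrite [RHS]integral_mkcond; apply: ae_eq_integral => //.
- exact: (measurable_fubini_F (m1 := mu) iphi).
- apply/(measurable_restrict _ mE measurableT); rewrite setTI.
  by apply/measurable_EFinP; apply: measurable_funTS;
    exact: coord_measurable_section_integral.
apply: filterS ae_cost_at => s cs _.
rewrite patchE /fubini_F /phi/= indicE; case: ifPn => sE.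
  under eq_integral do rewrite mul1r.
  by rewrite section_integralE//; apply: ET; exact/set_mem.
by under eq_integral do rewrite mul0r; rewrite integral0.
Qed.

End section_integral.

(** If the controls of the transitions, multiplied by the square roots of the
    fluxes, are the masses that psi gives to the sets of the transitions, then
    both controls drive the same equation. *)
Lemma bochner_transfer (u : nat -> nat -> R -> R) :
  (forall s i j, timeT s -> (cost_at s < +oo)%E -> j != i ->
    Num.sqrt (p s i * Gamma (p s) i j) * u i j s =
    cell_integral Gamma (p s) (fun y => psit (s, y)) i j) ->
  forall t w, 0 <= t <= T ->
    is_bochner_integral lam (`[0, t] `*` @XX R)
      (fun z => psi z *: jump Gamma (p z.1) z.2) w <->
    is_bochner_integral mu `[0, t]
      (fun s => \sum_(i <oo) \sum_(j <oo | j != i)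
         (Num.sqrt (p s i * Gamma (p s) i j) * u i j s) *:
           (unit_vector R j - unit_vector R i)) w.
Proof.
move=> uP t w /andP[t0 tT].
have [g [g_int g_out]] := section_integral_exists.
have mE : measurable (`[0, t]%classic : set T1) by exact: measurable_itv.
have ET s : (`[0, t]%classic : set T1) s -> timeT s.
  by rewrite /= !in_itv/= => /andP[-> /le_trans ->].
have mD : measurable (`[0, t]%classic `*` @XX R : set T3).
  by apply: measurableX => //; exact: measurable_XX.
have Df (z : T3) : (`[0, t]%classic `*` @XX R) z ->
    psi z *: jump Gamma (p z.1) z.2 = weighted_jump z.
  move=> [zt zX]; rewrite /weighted_jump /extended_control patchE mem_set//.
  by split => //; exact: ET.
have fi : norm_integrable lam (`[0, t]%classic `*` @XX R : set T3)
    (fun z : T3 => psi z *: jump Gamma (p z.1) z.2).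
  split.
    move=> k; apply: (@eq_measurable_fun _ _ _ _ _ (fun z =>
      weighted_jump z k)).
      by move=> z /set_mem zD; rewrite -Df.
    by apply: measurable_funTS; exact: coord_measurable_weighted_jump.
  have /integrableP[_] := integrable_norm_weighted_jump.
  apply: le_lt_trans; apply: le_lower_integral => // z zD; split => //.
  by rewrite Df// /= normr_id.
have gi := norm_integrable_section_integral g_int g_out tT.
have fug : {ae mu, forall s : T1, (`[0, t]%classic : set T1) s ->
    \sum_(i <oo) \sum_(j <oo | j != i)
      (Num.sqrt (p s i * Gamma (p s) i j) * u i j s) *:
        (unit_vector R j - unit_vector R i) = g s}.
  apply: filterS ae_cost_at => s cs st; have sT := ET _ st.
  rewrite -(series_weak_integral Gamma_rate rate_sup_fin (timeP sT)
    (measurable_section s) cs (g_int _ sT cs)).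
  congr (limn _); apply/funext => n; apply: eq_bigr => i _.
  congr (limn _); apply/funext => m; apply: eq_bigr => j ji.
  by rewrite uP.
rewrite (bochner_weakP w mD fi (aeW _ (fun _ _ => erefl))).
rewrite (bochner_weakP w mE gi fug).
have E k := integral_weighted_jump g_int g_out k tT.
by split=> H k; rewrite (H k); [exact: E|exact: esym (E k)].
Qed.

End transport.

(** * Comparison of the infima *)

Section controls.
Context (R : realType) (Gamma : l2 R -> nat -> nat -> R) (LG T : R).
Variable p : R -> l2 R.
Variable Db : l2 R -> {linear l2 R -> l2 R}.
Hypothesis Gamma_rate : forall q, simplex q -> rate_matrix (Gamma q).
Hypothesis rate_sup_fin : (rate_sup Gamma < +oo)%E.
Hypothesis Gamma_lip : forall q q' : l2 R, simplex q -> simplex q' ->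
  (ereal_sup (range (fun i =>
     \sum_(j <oo | j != i) (`|Gamma q' i j - Gamma q i j|)%:E))
   <= (LG * `|q' - q|)%:E)%E.
Hypothesis T_gt0 : 0 < T.
Hypothesis p_simplex : forall t, 0 <= t <= T -> simplex (p t).
Hypothesis p_cont : {within `[0, T], continuous p}.
Variable eta : R -> l2 R.

Local Notation T1 := (measurableTypeR R).
Local Notation T2 := (T1 * T1)%type.
Local Notation T3 := (T1 * T2)%type.
Local Notation mu := (@lebesgue_measure R).
Local Notation mu2 := (@lebesgue2 R).
Local Notation lam := (@lambda R).
Local Notation timeT := (`[0, T]%classic : set T1).
Local Notation domT := (timeT `*` (@XX R : set T2)).
Local Notation flux := (flux Gamma p).

Let timeP s : timeT s -> simplex (p s).
Proof. by rewrite /= in_itv => /p_simplex. Qed.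

Let mtime : measurable timeT. Proof. exact: measurable_itv. Qed.

Section from_psi.
Variable psi : T3 -> R.
Hypothesis psiL2 : L2_fun lam domT psi.
Local Notation psit := (extended_control T psi).

(** The control of a transition: the mass that psi gives to the set of the
    transition, divided by the square root of the flux; 0
    where the flux is 0. *)
Definition u_of_psi (i j : nat) (s : R) : R :=
  if j == i then 0 else
  cell_integral Gamma (p s) (fun y => psit (s, y)) i j / Num.sqrt (flux s i j).

Lemma u_of_psi_cost s : timeT s ->
  (\sum_(i <oo) \sum_(j <oo | j != i) (u_of_psi i j s ^+ 2)%:E <=
   cost_at T psi s)%E.
Proof.
move=> sT.
apply: le_trans (cell_cost_le Gamma_rate rate_sup_fin (timeP sT)
  (measurable_section psiL2 s)).
rewrite le_eqVlt; apply/orP; left; apply/eqP.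
apply: eq_eseriesr => i _; apply: eq_eseriesr => j ji.
by rewrite /u_of_psi (negPf ji).
Qed.

Lemma measurable_u_of_psi i j : measurable_fun timeT (u_of_psi i j : T1 -> R).
Proof.
rewrite /u_of_psi; case: eqVneq => ji; first exact: measurable_cst.
have mg : measurable (jump_graph Gamma T p i j : set T3).
  exact: (measurable_jump_graph rate_sup_fin Gamma_lip p_simplex
    p_cont ji).
pose phi (z : T3) : R := psit z * \1_(jump_graph Gamma T p i j) z.
have iphi : lam.-integrable setT (EFin \o phi).
  apply: (@integrable_dominated _ _ _ _ Gamma_rate rate_sup_fin T_gt0 p_simplex
    psi psiL2 phi 1) => //.
  - apply: measurable_funM; first exact: measurable_extended_control.
    exact: measurable_indic.
  - move=> s y sT; rewrite /phi indic_jump_graph//.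
    apply: (@jump_bound_ge _ _ _ (fun y => psit (s, y)) 1 R^o
      (\1_(jump_set Gamma (p s) i j) y) y) => //.
    rewrite ger0_norm// mul1r !indicE ler_nat.
    case: (boolP (y \in jump_set Gamma (p s) i j)) => // /set_mem Ay.
    by rewrite mem_set//; exists i => //; exists j.
  - by move=> s y sT; rewrite /phi extended_control_out// mul0r.
apply: (@eq_measurable_fun _ _ _ _ _ (fun s =>
    (fine \o fubini_F mu2 (EFin \o phi)) s * flux s i j `^ (- 2^-1) : R)).
  move=> s /set_mem sT; rewrite powRN powR12_sqrt//; last first.
    exact: (flux_ge0 Gamma_rate (timeP sT)).
  congr (_ * _); congr fine; apply: eq_integral => y _.
  by rewrite /= /phi indic_jump_graph.
apply: measurable_funM; last first.
  apply: (measurableT_comp (measurable_powR (- 2^-1))).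
  exact: (measurable_flux Gamma_lip p_simplex p_cont ji).
apply: measurable_funTS.
apply: (measurableT_comp (fine_measurable measurableT)).
exact: (measurable_fubini_F (m1 := mu) iphi).
Qed.

Lemma u_of_psi_total_cost :
  (\int[mu]_(s in timeT)
     (\sum_(i <oo) \sum_(j <oo | j != i) (u_of_psi i j s ^+ 2)%:E) <=
   \int[lam]_(z in domT) (psi z ^+ 2)%:E)%E.
Proof.
rewrite -(integral_cost_at psiL2); apply: le_lower_integral.
- move=> s _; apply: nneseries_ge0 => i _ _; apply: nneseries_ge0 => j _ _.
  by rewrite lee_fin sqr_ge0.
- by move=> s _; exact: cost_at_ge0.
- by move=> s sT; split => //; exact: u_of_psi_cost.
Qed.

Lemma u_of_psi_L2 i j : L2_fun mu timeT (u_of_psi i j).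
Proof.
split; first exact: measurable_u_of_psi.
apply: le_lt_trans psiL2.2; apply: le_trans u_of_psi_total_cost.
apply: le_lower_integral.
- by move=> s _; rewrite lee_fin sqr_ge0.
- move=> s _; apply: nneseries_ge0 => k _ _; apply: nneseries_ge0 => l _ _.
  by rewrite lee_fin sqr_ge0.
move=> s sT; split => //.
have [ji|ji] := eqVneq j i.
  rewrite /u_of_psi ji eqxx expr0n/=.
  apply: nneseries_ge0 => k _ _; apply: nneseries_ge0 => l _ _.
  by rewrite lee_fin sqr_ge0.
apply: (@le_trans _ _ (\sum_(j <oo | j != i) (u_of_psi i j s ^+ 2)%:E)%E).
  apply: (@nneseries_term_le _ (fun j => (u_of_psi i j s ^+ 2)%:E)
    (fun j => j != i)) => // k _.
  by rewrite lee_fin sqr_ge0.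
apply: (@nneseries_term_le _
  (fun i => \sum_(j <oo | j != i) (u_of_psi i j s ^+ 2)%:E)%E xpredT) => // k _.
by apply: nneseries_ge0 => l _ _; rewrite lee_fin sqr_ge0.
Qed.

Lemma u_of_psi_controlled : controlled_by_psi Gamma T p Db eta psi ->
  controlled_by_u Gamma T p Db eta u_of_psi.
Proof.
move=> H t tT; have [v [w [hv hw e]]] := H t tT; exists v, w; split => //.
apply: (bochner_transfer Gamma_rate rate_sup_fin Gamma_lip T_gt0 p_simplex
  p_cont psiL2 _ w tT).1 hw.
move=> s i j sT cs ji; rewrite /u_of_psi (negPf ji) -/(flux s i j).
(* Where the flux vanishes, so does the mass: the set of the transition is
   null. *)
have [f0|fn0] := eqVneq (flux s i j) 0.
  rewrite f0 sqrtr0 mul0r.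
  rewrite (cell_integral_null Gamma_rate rate_sup_fin (timeP sT))//.
  exact: measurable_section.
rewrite mulrCA mulfV ?mulr1// sqrtr_eq0 -ltNge lt_neqAle eq_sym fn0/=.
exact: (flux_ge0 Gamma_rate (timeP sT)).
Qed.

End from_psi.

Section from_u.
Variable u : nat -> nat -> R -> R.
Hypothesis uL2 : forall i j, L2_fun mu timeT (u i j).
Hypothesis u_cost : (\int[mu]_(s in timeT)
  (\sum_(i <oo) \sum_(j <oo | j != i) (u i j s ^+ 2)%:E) < +oo)%E.

(** The control that at each time of [0, T] spreads the controls of the
    transitions over their sets, and vanishes at the other times. *)
Definition psi_of_u : T3 -> R :=
  (fun z => spread_control Gamma (p z.1) (fun i j => u i j z.1) z.2)
    \_ (strip T).

Lemma psi_of_uE s y : timeT s ->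
  psi_of_u (s, y) = spread_control Gamma (p s) (fun i j => u i j s) y.
Proof. by move=> sT; rewrite /psi_of_u patchE mem_set//; split. Qed.

Lemma measurable_psi_of_u : measurable_fun setT psi_of_u.
Proof.
apply/(measurable_restrict _ (measurable_strip T) measurableT); rewrite setTI.
apply: (measurable_spread_control Gamma_rate rate_sup_fin Gamma_lip p_simplex
  p_cont).
by move=> i j; exact: (uL2 i j).1.
Qed.

Lemma psi_of_u_cost :
  (\int[lam]_(z in domT) (psi_of_u z ^+ 2)%:E <=
   \int[mu]_(s in timeT)
     (\sum_(i <oo) \sum_(j <oo | j != i) (u i j s ^+ 2)%:E))%E.
Proof.
apply: (@le_trans _ _ (\int[lam]_z (psi_of_u z ^+ 2)%:E)%E).
  by apply: le_lower_integral => // z _; rewrite lee_fin sqr_ge0.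
have mp2 : measurable_fun setT (fun z : T3 => (psi_of_u z ^+ 2)%:E).
  by apply/measurable_EFinP; apply: measurable_funX; exact: measurable_psi_of_u.
have p20 (z : T3) : (0 <= (psi_of_u z ^+ 2)%:E)%E by rewrite lee_fin sqr_ge0.
apply: le_trans (_ : \int[mu]_s fubini_F mu2 (fun z =>
  (psi_of_u z ^+ 2)%:E) s <= _)%E.
  rewrite le_eqVlt; apply/orP; left; apply/eqP.
  exact: (fubini_tonelli1 (m1 := mu) (m2 := mu2) _ mp2 p20).
have u0 s : (0 <= \sum_(i <oo) \sum_(j <oo | j != i) (u i j s ^+ 2)%:E)%E.
  apply: nneseries_ge0 => i _ _; apply: nneseries_ge0 => j _ _.
  by rewrite lee_fin sqr_ge0.
rewrite [leRHS]integral_mkcond; apply: le_lower_integral.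
- by move=> s _; apply: integral_ge0 => y _.
- by move=> s _; rewrite patchE; case: ifPn.
move=> s _; split => //; rewrite patchE; case: ifPn => [/set_mem sT|sT].
  apply: le_trans (spread_control_cost Gamma_rate rate_sup_fin (timeP sT)
    (fun i j => u i j s)).
  apply: le_lower_integral; [by []|by move=> y _; rewrite lee_fin sqr_ge0|].
  by move=> y _; split => //; rewrite psi_of_uE.
apply: (@le_trans _ _ (\int[mu2]_y (cst 0%E y))%E); last by rewrite integral0.
apply: le_lower_integral; [by []|by []|move=> y _; split => //].
rewrite /psi_of_u patchE memNset ?expr0n//= => -[sT' _].
by move: sT; rewrite notin_setE; apply.
Qed.

Lemma psi_of_u_L2 : L2_fun lam domT psi_of_u.
Proof.
split; first exact: measurable_funTS measurable_psi_of_u.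
exact: le_lt_trans psi_of_u_cost u_cost.
Qed.

Lemma psi_of_u_controlled : controlled_by_u Gamma T p Db eta u ->
  controlled_by_psi Gamma T p Db eta psi_of_u.
Proof.
move=> H t tT; have [v [w [hv hw e]]] := H t tT; exists v, w; split => //.
apply: (bochner_transfer Gamma_rate rate_sup_fin Gamma_lip T_gt0 p_simplex
  p_cont psi_of_u_L2 _ w tT).2 hw.
move=> s i j sT cs ji.
rewrite -(spread_control_cell_integral Gamma_rate rate_sup_fin (timeP sT)
  (fun i j => u i j s) ji).
apply: eq_Rintegral => y _.
rewrite indicE; case: (boolP (y \in _)) => [/set_mem [yX _ _]|_]; last first.
  by rewrite !mulr0.
rewrite /extended_control patchE mem_set; last by split.
by rewrite psi_of_uE.
Qed.

End from_u.

Lemma rate_I_eq_Ibar :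
  rate_I Gamma T p Db eta = Ibar Gamma T p Db eta.
Proof.
apply/eqP; rewrite eq_le; apply/andP; split.
  apply/ereal_infP => _ [psi [psiL2 psiC] <-].
  apply: (@le_trans _ _ (2^-1%:E * \int[mu]_(s in timeT)
     (\sum_(i <oo) \sum_(j <oo | j != i) (u_of_psi psi i j s ^+ 2)%:E))%E).
    apply: ereal_inf_lbound; exists (u_of_psi psi) => //; split.
      by move=> i j; exact: u_of_psi_L2.
    exact: u_of_psi_controlled.
  by apply: lee_wpmul2l; [rewrite lee_fin|exact: u_of_psi_total_cost].
apply/ereal_infP => _ [u [uL2 uC] <-].
(* A control of infinite cost does not lower the infimum. *)
have [cy|] := eqVneq (\int[mu]_(s in timeT)
    (\sum_(i <oo) \sum_(j <oo | j != i) (u i j s ^+ 2)%:E))%E +oo%E.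
  by rewrite cy gt0_muley ?leey// lte_fin.
rewrite -ltey => uc.
apply: (@le_trans _ _ (2^-1%:E * \int[lam]_(z in domT) (psi_of_u u z ^+
  2)%:E)%E).
  apply: ereal_inf_lbound; exists (psi_of_u u) => //; split.
    exact: psi_of_u_L2.
  exact: psi_of_u_controlled.
by apply: lee_wpmul2l; [rewrite lee_fin|exact: psi_of_u_cost].
Qed.

End controls.

Theorem theorem3p3 (R : realType) (T : R) (a : nat -> R)
    (Gamma : l2 R -> nat -> nat -> R) (x : forall m : nat, 'I_m -> nat)
    (cG LG cb : R) (Db : l2 R -> {linear l2 R -> l2 R})
    (theta : l2 R -> l2 R -> l2 R) (p : R -> l2 R)
    (T_gt0 : 0 < T)
    (a_gt0 : forall m, (0 < m)%N -> 0 < a m)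
    (a_cvg0 : a m @[m --> \oo] --> 0)
    (a_sqrt_cvg : a m * Num.sqrt m%:R @[m --> \oo] --> +oo)
    (Gamma_rate : forall q, simplex q -> rate_matrix (Gamma q))
    (* (a) *)
    (rate_sup_fin : (rate_sup Gamma < +oo)%E)
    (* (b) *)
    (cG_gt0 : 0 < cG) (LG_gt0 : 0 < LG)
    (Gamma_col : (ereal_sup [set ereal_sup
        (range (fun j => \sum_(i <oo) (`|Gamma q i j|)%:E))
        | q in @simplex R] <= cG%:E)%E)
    (Gamma_lip : forall q q' : l2 R, simplex q -> simplex q' ->
      (ereal_sup (range (fun i =>
         \sum_(j <oo | j != i) (`|Gamma q' i j - Gamma q i j|)%:E))
       <= (LG * `|q' - q|)%:E)%E)
    (* (c) *)
    (cb_gt0 : 0 < cb)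
    (drift_expansion : forall q q' : l2 R, simplex q -> simplex q' ->
      [/\ drift Gamma q' - drift Gamma q = Db q (q' - q) + theta q q',
          `|theta q q'| <= cb * `|q' - q| ^+ 2 &
          (op_norm (Db q) <= cb%:E)%E])
    (* (d) *)
    (p_solution : mean_field_solution Gamma T p)
    (p0_approx :
      a m * Num.sqrt m%:R * `|empirical R (x m) - p 0| @[m --> \oo] --> 0) :
  forall eta : R -> l2 R, cadlag T eta ->
    rate_I Gamma T p Db eta = Ibar Gamma T p Db eta.
Proof.
have [p_simplex p_cont _] := p_solution.
move=> eta _; exact: (rate_I_eq_Ibar Db Gamma_rate rate_sup_fin Gamma_lip T_gt0
  p_simplex p_cont eta).
Qed.
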